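(* For every integer $n \ge 1$, the maximum number of $5$-cycles (as subgraphs) in a triangle-free graph on $n$ vertices is \[ \prod_{i=0}^4\left\lfloor\frac{n+i}{5}\right\rfloor . \] Moreover, for $n \ge 5$, the only triangle-free graphs on $n$ vertices attaining this maximum are the balanced blow-ups of $C_5$, together with the M\''obius ladder $ML_8$ in the special case $n=8$.
   Context: A blow-up of the $5$-cycle $C_5$ on $n$ vertices is obtained by replacing each vertex of $C_5$ by an independent set (the five sets partitioning the $n$ vertices) and each edge of $C_5$ by a complete bipartite graph between the corresponding sets; no other edges are present. It is balanced if every one of the five sets has size $\lfloor n/5\rfloor$ or $\lceil n/5\rceil$. The M\''obius ladder $ML_8$ is the $8$-cycle with all four of its long diagonals added (each vertex joined to the vertex at distance $4$ on the cycle). *)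

(* Defs.v *)
From mathcomp Require Import all_boot.

Set Implicit Arguments.
Unset Strict Implicit.
Unset Printing Implicit Defensive.

Record sgraph (V : finType) := SGraph {
  adj :> rel V;
  adj_sym : symmetric adj;
  adj_irr : irreflexive adj
}.

Definition isomorphic (V W : finType) (G : sgraph V) (H : sgraph W) : Prop :=
  exists f : V -> W, bijective f /\ forall x y : V, H (f x) (f y) = G x y.

Definition triangle_free (V : finType) (G : sgraph V) : Prop :=
  forall x y z : V, ~ [/\ G x y, G y z & G x z].

Definition edges (V : finType) (G : sgraph V) : {set {set V}} :=
  [set [set p.1; p.2] | p : V * V & G p.1 p.2].

(* [ordS i] is i + 1 modulo k, so this is the k-cycle for k >= 3. *)
Definition cycle_rel (k : nat) : rel 'I_k :=
  fun i j => (j == ordS i) || (i == ordS j).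

Lemma C5_sym : symmetric (@cycle_rel 5).
Proof. by move=> i j; rewrite /cycle_rel orbC. Qed.

Lemma C5_irr : irreflexive (@cycle_rel 5).
Proof. by case; do 5?[case=> //]. Qed.

Definition C5 : sgraph 'I_5 := SGraph C5_sym C5_irr.

Definition ML8_rel : rel 'I_8 :=
  fun i j => cycle_rel i j || (j == (i + 4) %% 8 :> nat).

Lemma ML8_sym : symmetric ML8_rel.
Proof. by case; do 8?[case=> //]; move=> ?; case; do 8?[case=> //]. Qed.

Lemma ML8_irr : irreflexive ML8_rel.
Proof. by case; do 8?[case=> //]. Qed.

Definition ML8 : sgraph 'I_8 := SGraph ML8_sym ML8_irr.

(* A 5-cycle of G, as a (not necessarily induced) subgraph, has no isolated
   vertex, so it is represented by its edge set: the image of the edges of C5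
   under an injective homomorphism.  The ten homomorphisms that trace out the
   same subgraph give the same edge set, so each subgraph is counted once. *)
Definition five_cycles (V : finType) (G : sgraph V) : {set {set {set V}}} :=
  [set [set f @: (a : {set 'I_5}) | a in edges C5] | f : {ffun 'I_5 -> V}
     & injectiveb f && [forall i, forall j, C5 i j ==> G (f i) (f j)]].

(* [phi] sends each vertex to the vertex of C5 whose class contains it. *)
Definition C5_blowup_map (V : finType) (G : sgraph V) (phi : V -> 'I_5) : Prop :=
  forall x y : V, G x y = C5 (phi x) (phi y).

(* (#|V| + 4) %/ 5 is the ceiling of #|V| / 5. *)
Definition balanced_C5_blowup (V : finType) (G : sgraph V) : Prop :=
  exists phi : V -> 'I_5, C5_blowup_map G phi /\
    forall i : 'I_5,
      #|[set x | phi x == i]| = #|V| %/ 5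
      \/ #|[set x | phi x == i]| = (#|V| + 4) %/ 5.

(* Main.v *)
(* Call a vertex bad for a pentagon P if it has at most one neighbour in P; by
   triangle-freeness every other vertex has exactly two, as if it were a clone
   of a vertex of P.  If some P has no bad vertex, the clone classes of P exhibit
   G as a subgraph of a blow-up of C5, so the number N of pentagons is at most
   the product of the class sizes, and the integer AM-GM inequality with its
   equality case finishes.

   Otherwise a flag algebra certificate gives the missing strictness.  Sampling
   six vertices with replacement and expanding a sum of squares yields, if every
   pentagon has at least k bad vertices,
     N (n + 1.63 k) <= n (n / 5)^5.
   For k = 1 this is below the claimed maximum except when n is 7 or 8 (the
   constant 1.63 is just large enough for n = 9).  For n = 7, 8 and N at the
   maximum, the case k = 2 provides a pentagon with exactly one bad vertex, and
   the few possible graphs are enumerated; only ML8 survives. *)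

From Stdlib Require Import ZArith.
Require Import Defs.
From mathcomp Require Import all_boot all_order all_algebra zify ssrZ.

Set Implicit Arguments.
Unset Strict Implicit.
Unset Printing Implicit Defensive.

Import Order.TTheory GRing.Theory Num.Theory.

Delimit Scope Z_scope with coqZ.

(** * The sum-of-squares certificate *)

(* The squares range over four types: a non-adjacent pair or an adjacent pair,
   each extended by two vertices, and K2 + 2 K1 or P3 + K1 on four vertices, each
   extended by one vertex.  The tables [*_index] map the bits describing an
   extension to the index of its isomorphism class (junk value 0 on patterns
   containing a triangle), and [*_squares] lists weighted linear forms in these
   classes: a rounded solution of a semidefinite program, followed by small
   multiples of basis vectors correcting the rounding. *)
Definition nonedge_index : seq nat :=
  [:: 0; 3; 2; 8; 1; 6; 5; 9; 2; 8; 7; 0; 10; 13; 12; 0; 1; 6; 10; 13; 4; 0;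
         11; 0; 5; 9; 12; 0; 11; 0; 14; 0].

Definition nonedge_squares : seq (Z * seq Z) :=
  [:: (4, [:: 2718; -1111; -862; -16001; -1580; 1746; -2962; -1654; -2946;
         -4518; 17991; 13982; 13880; -20031; 10534]);
      (4, [:: 0; -11757; 12202; 382; 6818; -375; -1634; -6874; 1549; 95; -433;
         9194; -9436; -277; -6]);
      (4, [:: 0; -289; 0; 550; 14746; -115; -7296; 6078; -3012; 2092; -149;
         5876; 1887; -9590; -4344]);
      (4, [:: 0; -1961; 0; -8036; 0; 4834; 243; -1344; 609; -575; 4574; 2739;
         1095; -1070; 334]);
      (4, [:: 0; -1017; 0; 2824; 0; 0; 2273; -200; 1205; -1471; -5944; -4135;
         -4226; 8177; 1530]);
      (4, [:: 0; 86; 0; 4; 0; 0; 0; 13334; -6654; 1385; -203; -469; 5506;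
         -6520; -2772]);
      (4, [:: 0; -33; 0; 1252; 0; 0; 0; 0; 1888; -760; -3843; -2102; -2788;
         4108; 894]);
      (4, [:: 0; -60; 0; -1036; 0; 0; 0; 0; 0; 5323; 1155; -1466; -1396;
         -2660; -10128]);
      (4, [:: 0; -1115; 0; -2568; 0; 0; 0; 0; 0; 0; 5658; 5070; 4399; -8996;
         1284]);
      (4, [:: 0; 209; 0; -284; 0; 0; 0; 0; 0; 0; 0; 11208; -10866; -622;
         142]);
      (4, [:: 0; 2204; 0; -2928; 0; 0; 0; 0; 0; 0; 0; 0; 3500; -6436; 1464]);
      (4, [:: 0; -1022; 0; -140; 0; 0; 0; 0; 0; 0; 0; 0; 0; 987; 70]);
      (4, [:: 0; -271; 0; -1084; 0; 0; 0; 0; 0; 0; 0; 0; 0; 0; 542]);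
      (612476, [:: 2; -4; 0; -7; 0; 0; 0; 0; 0; 0; 0; 0; 0; 0; 0]);
      (673076, [:: 0; -1; 1; 0; 0; 0; 0; 0; 0; 0; 0; 0; 0; 0; 0]);
      (663332, [:: 0; -1; 0; 0; 2; 0; 0; 0; 0; 0; 0; 0; 0; 0; 0]);
      (568552, [:: 0; 0; 0; -2; 0; 1; 0; 0; 0; 0; 0; 0; 0; 0; 0]);
      (547123, [:: 0; -1; 0; 0; 0; 0; 1; 0; 0; 0; 0; 0; 0; 0; 0]);
      (573460, [:: 0; -1; 0; 0; 0; 0; 0; 2; 0; 0; 0; 0; 0; 0; 0]);
      (662258, [:: 0; -1; 0; 0; 0; 0; 0; 0; 1; 0; 0; 0; 0; 0; 0]);
      (563938, [:: 0; -2; 0; -4; 0; 0; 0; 0; 0; 1; 0; 0; 0; 0; 0]);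
      (615540, [:: 0; 0; 0; 0; 0; 0; 0; 0; 0; 0; 1; 0; 0; 0; 0]);
      (549316, [:: 0; -1; 0; 0; 0; 0; 0; 0; 0; 0; 0; 1; 0; 0; 0]);
      (274305, [:: 0; -1; 0; 0; 0; 0; 0; 0; 0; 0; 0; 0; 1; 0; 0]);
      (666632, [:: 0; -1; 0; 0; 0; 0; 0; 0; 0; 0; 0; 0; 0; 1; 0]);
      (686134, [:: 0; -1; 0; -4; 0; 0; 0; 0; 0; 0; 0; 0; 0; 0; 2])]%coqZ.

Definition edge_index : seq nat :=
  [:: 0; 5; 2; 8; 1; 7; 0; 0; 2; 8; 4; 0; 6; 9; 0; 0; 1; 7; 6; 9; 3; 0; 0; 0;
         0; 0; 0; 0; 0; 0; 0; 0].

Definition edge_squares : seq (Z * seq Z) :=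
  [:: (4, [:: 13800; -3621; -3345; -84; -166; -5092; -6048; 1236; 1499;
         1293]);
      (4, [:: 0; -7273; 10217; 1567; -3825; 5345; -5977; -10560; 6676; 3811]);
      (4, [:: 0; -4279; 0; 6799; 2347; -8419; 7691; -2005; 6164; -8621]);
      (4, [:: 0; -456; 0; 0; 5287; -1375; 87; 2885; -3535; -3185]);
      (4, [:: 0; 4749; 0; 0; 0; 12915; -13656; -2170; -5003; 5360]);
      (4, [:: 0; -739; 0; 0; 0; 0; 16111; -7375; -6941; -352]);
      (4, [:: 0; -721; 0; 0; 0; 0; 0; 15891; -14141; -343]);
      (4, [:: 0; -3457; 0; 0; 0; 0; 0; 0; 8395; -1646]);
      (4, [:: 0; -804; 0; 0; 0; 0; 0; 0; 0; 268]);
      (482824, [:: 2; -1; 0; 0; 0; 0; 0; 0; 0; 0]);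
      (829705, [:: 0; -1; 1; 0; 0; 0; 0; 0; 0; 0]);
      (639712, [:: 0; -2; 0; 1; 0; 0; 0; 0; 0; 0]);
      (607452, [:: 0; -2; 0; 0; 1; 0; 0; 0; 0; 0]);
      (615540, [:: 0; 0; 0; 0; 0; 1; 0; 0; 0; 0]);
      (386092, [:: 0; -1; 0; 0; 0; 0; 1; 0; 0; 0]);
      (751640, [:: 0; -1; 0; 0; 0; 0; 0; 1; 0; 0]);
      (941620, [:: 0; -1; 0; 0; 0; 0; 0; 0; 1; 0]);
      (604296, [:: 0; -3; 0; 0; 0; 0; 0; 0; 0; 1])]%coqZ.

Definition edge_iso2_index : seq nat :=
  [:: 0; 4; 3; 9; 2; 8; 7; 11; 1; 6; 5; 10; 0; 0; 0; 0].

Definition edge_iso2_squares : seq (Z * seq Z) :=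
  [:: (4, [:: 1283; 16509; -10929; 3918; 3918; -2125; -2125; -2906; -2906;
         -7207; 15271; -22134]);
      (4, [:: 2845; 0; 12374; 8687; 8687; -5754; -5754; -5402; -5402; -15981;
         -16044; 825]);
      (4, [:: 744; 0; 0; 11298; -3795; 6131; -8949; 6131; -8949; -936; -372;
         -372]);
      (4, [:: 1054; 0; 0; 0; 10641; -7314; 3317; -7314; 3317; -1327; -527;
         -527]);
      (4, [:: -3; 0; 0; 0; 0; 30133; 30123; -30121; -30126; 2; -11277;
         11280]);
      (4, [:: 0; 0; 0; 0; 0; 0; 786; -589; -197; 0; -147; 147]);
      (4, [:: -231; 0; 0; 0; 0; 0; 0; 597; 209; 241; 191; 40]);
      (4, [:: -160; 0; 0; 0; 0; 0; 0; 0; 560; 167; 132; 28]);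
      (4, [:: -440; 0; 0; 0; 0; 0; 0; 0; 0; 678; 220; 220]);
      (4, [:: -353; 0; 0; 0; 0; 0; 0; 0; 0; 0; 575; -222]);
      (4, [:: -531; 0; 0; 0; 0; 0; 0; 0; 0; 0; 0; 531]);
      (1931296, [:: -1; 1; 0; 0; 0; 0; 0; 0; 0; 0; 0; 0]);
      (1931296, [:: -1; 0; 1; 0; 0; 0; 0; 0; 0; 0; 0; 0]);
      (2462164, [:: 0; 0; 0; 1; 0; 0; 0; 0; 0; 0; 0; 0]);
      (2462164, [:: 0; 0; 0; 0; 1; 0; 0; 0; 0; 0; 0; 0]);
      (2462164, [:: 0; 0; 0; 0; 0; 1; 0; 0; 0; 0; 0; 0]);
      (2462164, [:: 0; 0; 0; 0; 0; 0; 1; 0; 0; 0; 0; 0]);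
      (2462164, [:: 0; 0; 0; 0; 0; 0; 0; 1; 0; 0; 0; 0]);
      (2462164, [:: 0; 0; 0; 0; 0; 0; 0; 0; 1; 0; 0; 0]);
      (2462164, [:: 0; 0; 0; 0; 0; 0; 0; 0; 0; 1; 0; 0]);
      (3293712, [:: -1; 0; 0; 0; 0; 0; 0; 0; 0; 0; 1; 0]);
      (3293704, [:: -1; 0; 0; 0; 0; 0; 0; 0; 0; 0; 0; 1])]%coqZ.

Definition path_iso1_index : seq nat :=
  [:: 0; 5; 3; 8; 2; 7; 4; 9; 1; 6; 0; 0; 0; 0; 0; 0].

Definition path_iso1_squares : seq (Z * seq Z) :=
  [:: (4, [:: -291; 12834; -10434; -10434; -11020; -1499; 11241; 732; 732;
         -12764]);
      (4, [:: 1105; 0; 63469; -31191; -6822; 5622; 5945; 18805; -75853;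
         -228]);
      (4, [:: 1891; 0; 0; 55277; -11683; 9628; 10182; -76485; -21209; -390]);
      (4, [:: -199; 0; 0; 0; 4229; -4019; -4098; 1385; 1385; 68]);
      (4, [:: -439; 0; 0; 0; 0; 669; 215; 166; 166; 224]);
      (4, [:: -403; 0; 0; 0; 0; 0; 506; -158; -158; -103]);
      (4, [:: -136; 0; 0; 0; 0; 0; 0; 743; 327; 136]);
      (4, [:: -85; 0; 0; 0; 0; 0; 0; 0; 668; 85]);
      (4, [:: -471; 0; 0; 0; 0; 0; 0; 0; 0; 471]);
      (2653344, [:: -1; 1; 0; 0; 0; 0; 0; 0; 0; 0]);
      (2462164, [:: 0; 0; 1; 0; 0; 0; 0; 0; 0; 0]);
      (2462164, [:: 0; 0; 0; 1; 0; 0; 0; 0; 0; 0]);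
      (2188500, [:: -1; 0; 0; 0; 1; 0; 0; 0; 0; 0]);
      (2462164, [:: 0; 0; 0; 0; 0; 1; 0; 0; 0; 0]);
      (2197240, [:: -1; 0; 0; 0; 0; 0; 1; 0; 0; 0]);
      (2462164, [:: 0; 0; 0; 0; 0; 0; 0; 1; 0; 0]);
      (2462164, [:: 0; 0; 0; 0; 0; 0; 0; 0; 1; 0]);
      (2666548, [:: -1; 0; 0; 0; 0; 0; 0; 0; 0; 1])]%coqZ.

Definition bin (s : seq bool) : nat := foldl (fun n (b : bool) => b + n.*2) 0 s.

Definition gram (k : nat) (sq : seq (Z * seq Z)) : seq (seq Z) :=
  [seq [seq foldr (fun q s => Z.add (Z.mul q.1 (Z.mul (nth Z0 q.2 i) (nth Z0 q.2 j))) s) Z0 sq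
       | j <- iota 0 k] | i <- iota 0 k].

Definition nonedge_gram := Eval vm_compute in gram 15 nonedge_squares.
Definition edge_gram := Eval vm_compute in gram 10 edge_squares.
Definition edge_iso2_gram := Eval vm_compute in gram 12 edge_iso2_squares.
Definition path_iso1_gram := Eval vm_compute in gram 10 path_iso1_squares.

Section Weight.
Variables (T : Type) (r : rel T).

Definition walk5 a b c d e := [&& r a b, r b c, r c d, r d e & r e a].

Definition nbrs5 a b c d e x : nat := r a x + (r b x + (r c x + (r d x + r e x))).

Definition flag2 (idx : seq nat) u v x y :=
  nth 0 idx (bin [:: r u x; r v x; r u y; r v y; r x y]).

Definition flag4 (idx : seq nat) a b c d x := nth 0 idx (bin [:: r a x; r b x; r c x; r d x]).

Definition entry (M : seq (seq Z)) i j := nth Z0 (nth [::] M i) j.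

Definition edge_iso2 a b c d := [&& r a b, ~~ r a c, ~~ r a d, ~~ r b c, ~~ r b d & ~~ r c d].
Definition path_iso1 a b c d := [&& r a b, r a c, ~~ r b c, ~~ r a d, ~~ r b d & ~~ r c d].

Definition sos2 (P : T -> T -> bool) idx M a b c d e f : Z :=
  if P a b then entry M (flag2 idx a b c d) (flag2 idx a b e f) else Z0.

Definition sos4 (P : T -> T -> T -> T -> bool) idx M a b c d e f : Z :=
  if P a b c d then entry M (flag4 idx a b c d e) (flag4 idx a b c d f) else Z0.

Definition pentagon_cost a b c d e f : Z :=
  if walk5 a b c d e then
    (if nbrs5 a b c d e f <= 1 then 26300000000%coqZ else 10000000000%coqZ)
  else Z0.

Definition squares a b c d e f : Z :=
  Z.add (sos2 (fun u v => ~~ r u v) nonedge_index nonedge_gram a b c d e f)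
 (Z.add (sos2 r edge_index edge_gram a b c d e f)
 (Z.add (sos4 edge_iso2 edge_iso2_index edge_iso2_gram a b c d e f)
        (sos4 path_iso1 path_iso1_index path_iso1_gram a b c d e f))).

(* All is scaled by 10^10: 32000000 is 10 / 5^5, the density of closed walks in the
   balanced blow-up, and each bad vertex adds 1.63 to the cost of a closed walk. *)
Definition slack a b c d e f : Z :=
  Z.sub 32000000%coqZ (Z.add (pentagon_cost a b c d e f) (squares a b c d e f)).
End Weight.

Definition app6 (T : Type) (F : T -> T -> T -> T -> T -> T -> Z) (x : T) (s : seq T) : Z :=
  F (nth x s 0) (nth x s 1) (nth x s 2) (nth x s 3) (nth x s 4) (nth x s 5).

(* A graph on [0, n) is given by its rows below the diagonal. *)
Definition look (K : seq (seq bool)) (i j : nat) : bool :=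
  if i < j then nth false (nth [::] K j) i
  else if j < i then nth false (nth [::] K i) j else false.

Fixpoint masks (n : nat) : seq (seq bool) :=
  if n is m.+1 then flatten [seq [:: true :: s; false :: s] | s <- masks m] else [:: [::]].

Definition independent (K : seq (seq bool)) (m : seq bool) : bool :=
  let n := size m in
  all (fun j => nth false m j ==>
    all (fun i => ~~ (nth false m i && look K i j)) (iota 0 j)) (iota 0 n).

(* [q] is a partial embedding of [0, size q), and [k] the number of vertices of [K]
   still to be placed.  [search] needs no correctness proof, as [isob] checks its
   result. *)
Fixpoint search (K L : seq (seq bool)) (n k : nat) (q : seq nat) : option (seq nat) :=
  if k is k'.+1 then
    let i := size q in
    foldr (fun x acc =>
      if (x \notin q) && all (fun j => look K j i == look L (nth 0 q j) x) (iota 0 i) then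
        if search K L n k' (rcons q x) is Some p then Some p else acc
      else acc) None (iota 0 n)
  else Some q.

Definition isob (n : nat) (K L : seq (seq bool)) : bool :=
  if sumn (map (count id) K) != sumn (map (count id) L) then false else
  if search K L n n [::] is Some q then
    perm_eq q (iota 0 n) &&
    all (fun j => all (fun i => look K i j == look L (nth 0 q i) (nth 0 q j))
      (iota 0 n)) (iota 0 n)
  else false.

Fixpoint reps (n : nat) : seq (seq (seq bool)) :=
  if n is m.+1 then
    foldr (fun c acc => if has (fun r => isob n r c) acc then acc else c :: acc) [::]
      (flatten [seq [seq rcons K s | s <- masks m & independent K s] | K <- reps m])
  else [:: [::]].

Definition slack_sum (K : seq (seq bool)) : Z :=
  foldr (fun p => Z.add (app6 (slack (look K)) 0 p)) Z0 (permutations (iota 0 6)).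

Lemma slack_sum_ge0 : all (fun K => Z.leb 0 (slack_sum K)) (reps 6).
Proof. by vm_compute. Qed.

Lemma masksP (m : seq bool) : m \in masks (size m).
Proof.
elim: m => [|b m IHm] //=; apply/flattenP.
exists [:: true :: m; false :: m]; first by apply/mapP; exists m.
by case: b; rewrite !inE eqxx ?orbT.
Qed.

Lemma isobP (n : nat) (K L : seq (seq bool)) : isob n K L ->
  exists2 q : seq nat, perm_eq q (iota 0 n) &
    forall i j, i < n -> j < n -> look K i j = look L (nth 0 q i) (nth 0 q j).
Proof.
rewrite /isob; case: ifP => // _; case: search => // q /andP[pq /allP h].
exists q => // i j lti ltj.
have /allP hj := h j ltac:(by rewrite mem_iota).
by apply/eqP/hj; rewrite mem_iota.
Qed.

Lemma repsP (n : nat) (K : seq (seq bool)) (s : seq bool) :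
    K \in reps n -> size s = n -> independent K s ->
  exists2 c, c \in reps n.+1 & c = rcons K s \/ isob n.+1 c (rcons K s).
Proof.
move=> Kn sn ind /=.
set l := flatten _.
have : rcons K s \in l.
  apply/flattenP; exists [seq rcons K s | s <- masks n & independent K s].
    by apply/mapP; exists K.
  by apply/mapP; exists s; rewrite // mem_filter ind -sn masksP.
elim: l => // c l IHl; rewrite inE => /predU1P[->|/IHl[d dl dP]] /=.
  case: ifP => [/hasP[d dl dP]|_]; first by exists d => //; right.
  by exists c; [rewrite inE eqxx | left].
by case: ifP => _; exists d => //; rewrite inE dl orbT.
Qed.

Lemma look_rcons (K : seq (seq bool)) (s : seq bool) (i j : nat) :
  i < size K -> j < size K -> look (rcons K s) i j = look K i j.
Proof. by rewrite /look !nth_rcons => -> ->. Qed.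

Lemma look_sym (K : seq (seq bool)) : symmetric (look K).
Proof. by move=> i j; rewrite /look; case: ltngtP. Qed.

Lemma size_reps (n : nat) (K : seq (seq bool)) : K \in reps n -> size K = n.
Proof.
elim: n K => [|n IHn] K; first by rewrite inE => /eqP->.
rewrite /=; set l := flatten _.
have : {in l, forall c, size c = n.+1}.
  move=> c /flattenP[_ /mapP[L /IHn Ln ->] /mapP[s _ ->]].
  by rewrite size_rcons Ln.
elim: l => // c l IHl lP; rewrite /=; case: ifP => _.
  by apply: IHl => d dl; apply: lP; rewrite inE dl orbT.
rewrite inE => /predU1P[->|]; first by apply: lP; rewrite inE eqxx.
by apply: IHl => d dl; apply: lP; rewrite inE dl orbT.
Qed.

Lemma perm_iota_lt (n i : nat) (q : seq nat) :
  perm_eq q (iota 0 n) -> i < n -> nth 0 q i < n.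
Proof.
move=> pq lti; have : nth 0 q i \in iota 0 n.
  by rewrite -(perm_mem pq) mem_nth // (perm_size pq) size_iota.
by rewrite mem_iota.
Qed.

Lemma perm_map_nth (T : eqType) (x0 : T) (n : nat) (p : seq nat) (s : seq T) :
  size s = n -> perm_eq p (iota 0 n) -> perm_eq [seq nth x0 s i | i <- p] s.
Proof.
move=> <- pp; rewrite -[X in perm_eq _ X](mkseq_nth x0).
exact: perm_map.
Qed.

Lemma perm_permutations_comp (n : nat) (q : seq nat) : perm_eq q (iota 0 n) ->
  perm_eq (permutations (iota 0 n))
    [seq [seq nth 0 q i | i <- p] | p <- permutations (iota 0 n)].
Proof.
move=> pq; have szq : size q = n by rewrite (perm_size pq) size_iota.
set f := fun p => [seq nth 0 q i | i <- p].
have uf : uniq [seq f p | p <- permutations (iota 0 n)].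
  rewrite map_inj_in_uniq ?permutations_uniq // => u v.
  rewrite !mem_permutations => pu pv.
  apply: (inj_in_map (A := mem (iota 0 n))); last 2 first.
  - by apply/allP => i; rewrite (perm_mem pu).
  - by apply/allP => i; rewrite (perm_mem pv).
  move=> i j; rewrite !mem_iota !add0n !leq0n => lti ltj /eqP.
  by rewrite nth_uniq ?szq // ?(perm_uniq pq) ?iota_uniq // => /eqP.
rewrite perm_sym; apply: uniq_perm; rewrite ?permutations_uniq //.
apply: (uniq_min_size uf _ _).2; last by rewrite size_map.
move=> _ /mapP[p pp ->]; move: pp; rewrite !mem_permutations => pp.
exact: perm_trans (perm_map_nth 0 szq pp) pq.
Qed.

Lemma app6_map (T : Type) (F : T -> T -> T -> T -> T -> T -> Z) (x : T)
    (h : nat -> T) (p : seq nat) : size p = 6 ->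
  app6 F x (map h p) = app6 (fun a b c d e f => F (h a) (h b) (h c) (h d) (h e) (h f)) 0 p.
Proof. by move=> szp; rewrite /app6 !(nth_map 0) ?szp. Qed.

Lemma foldr_Zadd (T : Type) (F : T -> Z) (s : seq T) :
  foldr (fun x => Z.add (F x)) Z0 s = (\sum_(x <- s) F x)%R.
Proof. by elim: s => [|x s IHs]; rewrite ?big_nil ?big_cons //= IHs. Qed.

Section Sampling.
Variables (V : finType) (G : sgraph V).
Hypothesis Gtf : triangle_free G.
Variable x0 : V.

Lemma reps_cover (n : nat) (t : seq V) : size t = n ->
  exists2 K, K \in reps n & exists2 q : seq nat, perm_eq q (iota 0 n) &
    forall i j, i < n -> j < n ->
      look K i j = G (nth x0 t (nth 0 q i)) (nth x0 t (nth 0 q j)).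
Proof.
elim: n t => [|n IHn] t; first by exists [::] => //; exists [::].
case/lastP: t => // t x; rewrite size_rcons => -[szt].
have [K Kn [q pq qP]] := IHn t szt.
have szK := size_reps Kn.
have szq : size q = n by rewrite (perm_size pq) size_iota.
pose s := [seq G (nth x0 t i) x | i <- q].
have szs : size s = n by rewrite size_map.
have sE i : i < n -> nth false s i = G (nth x0 t (nth 0 q i)) x.
  by move=> lti; rewrite (nth_map 0) ?szq.
have ind : independent K s.
  apply/allP => j; rewrite mem_iota szs /= => ltj; apply/implyP => sj.
  apply/allP => i; rewrite mem_iota /= => ltij; apply/negP => /andP[si].
  have lti := ltn_trans ltij ltj.
  rewrite qP // => Gij.
  by rewrite !sE // in si sj; case: (Gtf (And3 Gij sj si)).
have [c cn cP] := repsP Kn szs ind.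
exists c => //.
pose q' := rcons q n.
have pq' : perm_eq q' (iota 0 n.+1).
  by rewrite /q' -addn1 iotaD -cats1 perm_cat2r.
have q'P i j : i < n.+1 -> j < n.+1 ->
    look (rcons K s) i j =
    G (nth x0 (rcons t x) (nth 0 q' i)) (nth x0 (rcons t x) (nth 0 q' j)).
  have main u v : u < v -> v < n.+1 -> look (rcons K s) u v =
      G (nth x0 (rcons t x) (nth 0 q' u)) (nth x0 (rcons t x) (nth 0 q' v)).
    move=> ltuv; rewrite ltnS leq_eqVlt => /predU1P[vn|ltv].
      subst v; rewrite /look ltuv /q' !nth_rcons szK szq ltnn eqxx ltuv sE //.
      by rewrite szt ltnn eqxx (perm_iota_lt pq).
    have ltu := ltn_trans ltuv ltv.
    rewrite look_rcons ?szK // /q' !nth_rcons szq ltv ltu szt.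
    by rewrite !(perm_iota_lt pq) // qP.
  move=> lti ltj; case: (ltngtP i j) => [ltij|ltji|->]; first exact: main.
    by rewrite look_sym main // adj_sym.
  by rewrite adj_irr /look ltnn.
case: cP => [->|/isobP[p pp pP]]; first by exists q'.
have szp : size p = n.+1 by rewrite (perm_size pp) size_iota.
exists [seq nth 0 q' i | i <- p].
  by apply: perm_trans pq'; apply: perm_map_nth => //; rewrite size_rcons szq.
by move=> i j lti ltj; rewrite pP // !(nth_map 0) ?szp // q'P // (perm_iota_lt pp).
Qed.

Lemma slack_look (K : seq (seq bool)) (h : nat -> V) (a b c d e f : nat) :
    (forall i j, i < 6 -> j < 6 -> look K i j = G (h i) (h j)) ->
    all (fun i => i < 6) [:: a; b; c; d; e; f] ->
  slack G (h a) (h b) (h c) (h d) (h e) (h f) = slack (look K) a b c d e f.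
Proof.
move=> KG /=; rewrite andbT => /and5P[ha hb hc hd /andP[he hf]].
rewrite /slack /pentagon_cost /squares /sos2 /sos4 /flag2 /flag4 /walk5 /nbrs5.
by rewrite /edge_iso2 /path_iso1 -!KG.
Qed.

Lemma slack_sum_relabel (K : seq (seq bool)) (t : seq V) (q : seq nat) :
    perm_eq q (iota 0 6) ->
    (forall i j, i < 6 -> j < 6 ->
      look K i j = G (nth x0 t (nth 0 q i)) (nth x0 t (nth 0 q j))) ->
  (\sum_(p <- permutations (iota 0 6)) app6 (slack G) x0 [seq nth x0 t i | i <- p])%R
    = slack_sum K.
Proof.
move=> pq qP; rewrite (perm_big _ (perm_permutations_comp pq)) big_map.
rewrite /slack_sum foldr_Zadd; apply: eq_big_seq => p.
rewrite mem_permutations => pp.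
have lt6 i : i < 6 -> nth 0 p i < 6 by exact: perm_iota_lt pp.
rewrite -map_comp app6_map; last by rewrite (perm_size pp).
rewrite /app6.
apply: (@slack_look K (fun i => nth x0 t (nth 0 q i))); first exact: qP.
by rewrite /= !lt6.
Qed.

Lemma sum_perm_slack_ge0 (t : seq V) : size t = 6 ->
  (0 <= \sum_(p <- permutations (iota 0 6))
     app6 (slack G) x0 [seq nth x0 t i | i <- p] :> Z)%R.
Proof.
move=> szt; have [K Kn [q pq qP]] := reps_cover szt.
rewrite (slack_sum_relabel pq qP).
exact: (allP slack_sum_ge0 K Kn).
Qed.

Lemma big_tuple_cons (R : nmodType) (n : nat) (F : seq V -> R) :
  (\sum_(t : n.+1.-tuple V) F t = \sum_x \sum_(t : n.-tuple V) F (x :: t))%R.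
Proof.
rewrite pair_big /= (reindex (fun p : V * n.-tuple V => cons_tuple p.1 p.2)) //.
exists (fun t : n.+1.-tuple V => (thead t, [tuple of behead t])) => [[x t]|t] _.
  by rewrite /= theadE; congr pair; apply: val_inj.
by rewrite [RHS]tuple_eta; apply: val_inj.
Qed.

Lemma big_tuple0 (R : nmodType) (F : seq V -> R) :
  (\sum_(t : 0.-tuple V) F t)%R = F [::].
Proof.
rewrite (big_pred1 (nil_tuple V)) // => t; apply/esym/eqP.
exact: tuple0.
Qed.

Lemma big_tuple_perm (R : nmodType) (n : nat) (F : seq V -> R) (p : seq nat) :
    perm_eq p (iota 0 n) ->
  (\sum_(t : n.-tuple V) F t = \sum_(t : n.-tuple V) F [seq nth x0 t i | i <- p])%R.
Proof.
move=> pp; have szp : size p == n by rewrite (perm_size pp) size_iota.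
pose h (t : n.-tuple V) : n.-tuple V := [tuple of map (nth x0 t) (Tuple szp)].
rewrite (reindex_inj (h := h)) //= => t u /(congr1 val)/= /eq_in_map tu.
apply: val_inj; apply: (@eq_from_nth _ x0); rewrite ?size_tuple // => i lti.
by apply: tu; rewrite /= (perm_mem pp) mem_iota.
Qed.

Lemma sum_slack_ge0 :
  (0 <= \sum_a \sum_b \sum_c \sum_d \sum_e \sum_f slack G a b c d e f :> Z)%R.
Proof.
have -> : (\sum_a \sum_b \sum_c \sum_d \sum_e \sum_f slack G a b c d e f
    = \sum_(t : 6.-tuple V) app6 (slack G) x0 t)%R.
  rewrite big_tuple_cons; apply: eq_bigr => a _.
  rewrite (big_tuple_cons _ (fun s => app6 _ _ (a :: s))); apply: eq_bigr => b _.
  rewrite (big_tuple_cons _ (fun s => app6 _ _ [:: a, b & s])); apply: eq_bigr => c _.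
  rewrite (big_tuple_cons _ (fun s => app6 _ _ [:: a, b, c & s])); apply: eq_bigr => d _.
  rewrite (big_tuple_cons _ (fun s => app6 _ _ [:: a, b, c, d & s])); apply: eq_bigr => e _.
  rewrite (big_tuple_cons _ (fun s => app6 _ _ [:: a, b, c, d, e & s])); apply: eq_bigr => f _.
  by rewrite (big_tuple0 (fun s => app6 _ _ [:: a, b, c, d, e, f & s])).
set S := (X in (0 <= X)%R).
have: (0 <= \sum_(p <- permutations (iota 0 6)) S)%R.
  rewrite (eq_big_seq (fun p => \sum_(t : 6.-tuple V)
      app6 (slack G) x0 [seq nth x0 t i | i <- p])%R) => [|p].
    rewrite exchange_big; apply: sumr_ge0 => t _.
    by apply: sum_perm_slack_ge0; rewrite size_tuple.
  by rewrite mem_permutations => pp; apply: big_tuple_perm.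
by rewrite big_const_seq iter_addr_0 count_predT size_permutations // pmulrn_lge0.
Qed.

End Sampling.
Definition nonneg_weights (sq : seq (Z * seq Z)) := all (fun q => Z.leb 0 q.1) sq.

Lemma entry_gram (k : nat) (sq : seq (Z * seq Z)) (i j : nat) : i < k -> j < k ->
  entry (gram k sq) i j = (\sum_(q <- sq) q.1 * (nth Z0 q.2 i * nth Z0 q.2 j))%R.
Proof.
move=> lti ltj; rewrite /entry /gram (nth_map 0) ?size_iota //.
by rewrite (nth_map 0) ?size_iota // !nth_iota // foldr_Zadd.
Qed.

Lemma gram_quad_ge0 (k : nat) (sq : seq (Z * seq Z)) (I : finType) (phi : I -> nat) :
    nonneg_weights sq -> (forall i, phi i < k) ->
  (0 <= \sum_i \sum_j entry (gram k sq) (phi i) (phi j) :> Z)%R.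
Proof.
move=> /allP sq_ge0 ltk.
have -> : (\sum_i \sum_j entry (gram k sq) (phi i) (phi j) =
    \sum_(q <- sq) q.1 * (\sum_i nth Z0 q.2 (phi i)) ^+ 2)%R.
  under eq_bigr do under eq_bigr do rewrite entry_gram //.
  under eq_bigr do rewrite exchange_big.
  rewrite exchange_big; apply: eq_bigr => q _ /=.
  rewrite expr2 big_distrlr /= mulr_sumr; apply: eq_bigr => i _.
  by rewrite mulr_sumr.
rewrite big_seq; apply: sumr_ge0 => q /sq_ge0 q0.
by apply: mulr_ge0; [exact: q0 | exact: sqr_ge0].
Qed.

Lemma nth_all_lt (k n : nat) (idx : seq nat) : 0 < k -> all (gtn k) idx -> nth 0 idx n < k.
Proof.
move=> k0 /all_nthP idxk; case: (ltnP n (size idx)) => [/idxk|nsz]; first exact.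
by rewrite nth_default.
Qed.

Section SquaresGe0.
Variables (V : finType) (r : rel V).

Lemma sum_sos2_ge0 P idx k sq : 0 < k -> all (gtn k) idx -> nonneg_weights sq ->
  (0 <= \sum_a \sum_b \sum_c \sum_d \sum_e \sum_f
     sos2 r P idx (gram k sq) a b c d e f :> Z)%R.
Proof.
move=> k0 idxk sq0; apply: sumr_ge0 => a _; apply: sumr_ge0 => b _.
rewrite /sos2; case: (P a b); last first.
  by do 4!(apply: sumr_ge0 => ? _).
rewrite pair_big /=; under eq_bigr do rewrite pair_big /=.
by apply: (gram_quad_ge0 (phi := fun p => flag2 r idx a b p.1 p.2)) => // p;
  exact: nth_all_lt.
Qed.

Lemma sum_sos4_ge0 P idx k sq : 0 < k -> all (gtn k) idx -> nonneg_weights sq ->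
  (0 <= \sum_a \sum_b \sum_c \sum_d \sum_e \sum_f
     sos4 r P idx (gram k sq) a b c d e f :> Z)%R.
Proof.
move=> k0 idxk sq0; apply: sumr_ge0 => a _; apply: sumr_ge0 => b _.
apply: sumr_ge0 => c _; apply: sumr_ge0 => d _.
rewrite /sos4; case: (P a b c d); last by do 2!(apply: sumr_ge0 => ? _).
by apply: gram_quad_ge0 => // p; exact: nth_all_lt.
Qed.

Lemma nonedge_gramE : nonedge_gram = gram 15 nonedge_squares.
Proof. by vm_compute. Qed.
Lemma edge_gramE : edge_gram = gram 10 edge_squares.
Proof. by vm_compute. Qed.
Lemma edge_iso2_gramE : edge_iso2_gram = gram 12 edge_iso2_squares.
Proof. by vm_compute. Qed.
Lemma path_iso1_gramE : path_iso1_gram = gram 10 path_iso1_squares.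
Proof. by vm_compute. Qed.

Lemma sum_squares_ge0 :
  (0 <= \sum_a \sum_b \sum_c \sum_d \sum_e \sum_f squares r a b c d e f :> Z)%R.
Proof.
rewrite /squares.
have big6D (F H : V -> V -> V -> V -> V -> V -> Z) :
    (\sum_a \sum_b \sum_c \sum_d \sum_e \sum_f Z.add (F a b c d e f) (H a b c d e f)
     = \sum_a \sum_b \sum_c \sum_d \sum_e \sum_f F a b c d e f
     + \sum_a \sum_b \sum_c \sum_d \sum_e \sum_f H a b c d e f)%R.
  by do 6!(rewrite -big_split; apply: eq_bigr => ? _ /=).
rewrite !big6D nonedge_gramE edge_gramE edge_iso2_gramE path_iso1_gramE.
by rewrite !addr_ge0 ?sum_sos2_ge0 ?sum_sos4_ge0.
Qed.
End SquaresGe0.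

Definition nhom5 (V : finType) (r : rel V) : nat :=
  \sum_a \sum_b \sum_c \sum_d \sum_e walk5 r a b c d e.

Definition nbad (V : finType) (r : rel V) (a b c d e : V) : nat :=
  #|[set x | nbrs5 r a b c d e x <= 1]|.

Lemma mulrnZ (x : Z) (m : nat) : (x *+ m)%R = Z.mul x (Z.of_nat m).
Proof.
elim: m => [|m IHm]; first by rewrite mulr0n Z.mul_0_r.
by rewrite mulrS IHm Nat2Z.inj_succ Z.mul_succ_r addrC.
Qed.

Lemma sum_pentagon_cost_ge (V : finType) (r : rel V) (k : nat) (a b c d e : V) :
    (walk5 r a b c d e -> k <= nbad r a b c d e) ->
  (10000000000%coqZ *+ (walk5 r a b c d e * #|V|) +
   16300000000%coqZ *+ (walk5 r a b c d e * k)
    <= \sum_f pentagon_cost r a b c d e f)%R.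
Proof.
rewrite /pentagon_cost; case: walk5 => [/(_ isT) bad|_]; last by rewrite big1.
rewrite !mul1n.
have -> : (\sum_f (if (nbrs5 r a b c d e f <= 1)%N then 26300000000%coqZ
      else 10000000000%coqZ)
    = 10000000000%coqZ *+ #|V| + 16300000000%coqZ *+ nbad r a b c d e)%R.
  pose B := [set x | nbrs5 r a b c d e x <= 1].
  transitivity (\sum_f (10000000000%coqZ +
      (if f \in B then 16300000000%coqZ else Z0)))%R.
    by apply: eq_bigr => f _; rewrite inE; case: ifP.
  by rewrite big_split -big_mkcond !sumr_const.
by rewrite lerD2l !mulrnZ; lia.
Qed.

Theorem nhom5_bound (V : finType) (G : sgraph V) (k : nat) : triangle_free G ->
    (forall a b c d e, walk5 G a b c d e -> k <= nbad G a b c d e) ->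
  25 * (nhom5 G * (100 * #|V| + 163 * k)) <= 8 * #|V| ^ 6.
Proof.
move=> Gtf Gbad.
have [x0 _|V0] := pickP {: V}; last first.
  by rewrite /nhom5 big1 // => a; have := V0 a.
have := sum_slack_ge0 Gtf x0.
have := sum_squares_ge0 G.
set Sq := (\sum_a _)%R => Sq0.
set n := #|V|.
have -> : (\sum_a \sum_b \sum_c \sum_d \sum_e \sum_f slack G a b c d e f =
    32000000%coqZ *+ (n ^ 6)%N -
   (\sum_a \sum_b \sum_c \sum_d \sum_e \sum_f pentagon_cost G a b c d e f + Sq))%R.
  transitivity (\sum_(a : V) \sum_(b : V) \sum_(c : V) \sum_(d : V) \sum_(e : V)
    \sum_(f : V) 32000000%coqZ -
    (\sum_a \sum_b \sum_c \sum_d \sum_e \sum_f pentagon_cost G a b c d e f + Sq))%R.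
    by do 6!(rewrite -big_split -sumrB; apply: eq_bigr => ? _ /=).
  by congr (_ - _)%R; rewrite !sumr_const -!mulrnA -/n !expnS expn0 muln1 !mulnA.
have cost_ge : (10000000000%coqZ *+ (nhom5 G * n)%N + 16300000000%coqZ *+ (nhom5 G * k)%N
   <= \sum_a \sum_b \sum_c \sum_d \sum_e \sum_f pentagon_cost G a b c d e f)%R.
  rewrite /nhom5.
  do 5!(rewrite !big_distrl /= !(big_morph _ (mulrnDr _) (mulr0n _)) -big_split /=;
        apply: ler_sum => ? _).
  exact: sum_pentagon_cost_ge (Gbad _ _ _ _ _).
move: (\sum_a _)%R Sq Sq0 cost_ge => C Sq Sq0.
rewrite !mulrnZ; move: (nhom5 G) => h; rewrite -/n.
lia.
Qed.
(** * Pentagons as closed walks *)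

Local Arguments C5 : simpl never.

Section Dihedral.
Local Open Scope ring_scope.

Lemma C5E (i j : 'I_5) : C5 i j = (j == i + 1) || (j == i - 1).
Proof.
have ordSE (k : 'I_5) : ordS k = k + 1 by apply: val_inj; rewrite /= addn1.
by rewrite /= /cycle_rel !ordSE (eq_sym j (i - 1)) subr_eq.
Qed.

Definition dihedral (s : 'I_5 * bool) (i : 'I_5) : 'I_5 := if s.2 then s.1 + i else s.1 - i.

Lemma dihedral_C5 s i j : C5 (dihedral s i) (dihedral s j) = C5 i j.
Proof.
rewrite !C5E /dihedral; case: s => c [] /=.
  by rewrite -!addrA !(inj_eq (addrI _)).
by rewrite -!addrA !(inj_eq (addrI _)) !eqr_oppLR !opprD !opprK orbC.
Qed.

Lemma dihedral_inv s : exists s', cancel (dihedral s') (dihedral s).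
Proof.
case: s => c []; [exists (- c, true) | exists (c, false)] => i; rewrite /dihedral /=.
  by rewrite addNKr.
by rewrite opprB addrC subrK.
Qed.

Lemma dihedral_inj (s s' : 'I_5 * bool) :
  dihedral s 0 = dihedral s' 0 -> dihedral s 1 = dihedral s' 1 -> s = s'.
Proof.
case: s s' => [c b] [c' b']; rewrite /dihedral /= !(addr0, subr0) !if_same => <-.
by case: b b' => [] [] // /addrI.
Qed.

Lemma sum_C5 (F : 'I_5 -> nat) (i : 'I_5) :
  (\sum_j C5 i j * F j = F (i + 1)%R + F (i - 1)%R)%N.
Proof.
have ne : i - 1 != i + 1 by rewrite (inj_eq (addrI _)).
rewrite (bigD1 (i + 1)) // (bigD1 (i - 1)) ?ne // !C5E !eqxx orbT !mul1n big1.
  by rewrite /= addn0.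
by move=> j /andP[/andP[_ /negPf h1] /negPf h2]; rewrite C5E h1 h2.
Qed.

Lemma sum_walk5_C5 (F : 'I_5 -> 'I_5 -> 'I_5 -> 'I_5 -> 'I_5 -> nat) :
  (\sum_a \sum_b \sum_c \sum_d \sum_e walk5 C5 a b c d e * F a b c d e =
   \sum_s F (dihedral s 0%R) (dihedral s 1%R) (dihedral s 2%R) (dihedral s 3%R)
            (dihedral s 4%R))%N.
Proof.
rewrite -(pair_bigA _ (fun c b => F (dihedral (c, b) 0) (dihedral (c, b) 1)
  (dihedral (c, b) 2) (dihedral (c, b) 3) (dihedral (c, b) 4))) /=.
apply: eq_bigr => i _; rewrite big_bool /dihedral /= addr0 subr0.
transitivity (\sum_b C5 i b * \sum_c C5 b c * \sum_d C5 c d *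
   \sum_e C5 d e * (C5 e i * F i b c d e))%N.
  apply: eq_bigr => b _; rewrite big_distrr; apply: eq_bigr => c _ /=.
  rewrite !big_distrr; apply: eq_bigr => d _ /=.
  rewrite !big_distrr; apply: eq_bigr => e _ /=.
  by rewrite -!mulnb !mulnA.
have C5_addl k : C5 (i + k) i = C5 k 0.
  by rewrite -(dihedral_C5 (i, true) k 0) -{2}[i]addr0.
rewrite !sum_C5 -!addrA !C5_addl.
repeat match goal with |- context [C5 ?k 0] =>
  let b := eval vm_compute in (C5 k 0) in change (C5 k 0) with b end.
rewrite !mul0n !mul1n !addn0 !add0n.
by congr (F _ _ _ _ _ + F _ _ _ _ _)%N; congr (_ + _)%R; apply: val_inj.
Qed.

Lemma ord5P (P : 'I_5 -> Prop) : P 0 -> P 1 -> P 2 -> P 3 -> P 4 -> forall i, P i.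
Proof.
move=> P0 P1 P2 P3 P4 i.
have : i \in [:: 0; 1; 2; 3; 4] by case: i => [[|[|[|[|[|]]]]]].
by rewrite !inE => /or4P[|||/orP[]] /eqP ->.
Qed.

Lemma walk5_C5_dihedral (s : 'I_5 -> 'I_5) :
  (forall i j, C5 i j -> C5 (s i) (s j)) -> exists d, forall i, s i = dihedral d i.
Proof.
move=> sC5.
pose F a b c d e : nat := [&& a == s 0, b == s 1, c == s 2, d == s 3 & e == s 4].
have : (0 < \sum_a \sum_b \sum_c \sum_d \sum_e walk5 C5 a b c d e * F a b c d e)%N.
  rewrite (bigD1 (s 0)) //; apply: ltn_addr; rewrite (bigD1 (s 1)) //; apply: ltn_addr.
  rewrite (bigD1 (s 2)) //; apply: ltn_addr; rewrite (bigD1 (s 3)) //; apply: ltn_addr.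
  rewrite (bigD1 (s 4)) //; apply: ltn_addr.
  by rewrite /F !eqxx /walk5 !sC5.
rewrite sum_walk5_C5 lt0n sum_nat_eq0 => /forallPn[d]; rewrite implyTb eqb0 negbK.
move=> /and5P[/eqP e0 /eqP e1 /eqP e2 /eqP e3 /eqP e4].
by exists d; apply: ord5P.
Qed.

End Dihedral.

Section Homs.
Variables (V : finType) (G : sgraph V).

Definition homset : {set {ffun 'I_5 -> V}} :=
  [set f : {ffun 'I_5 -> V} | [forall i, forall j, C5 i j ==> G (f i) (f j)]].

Lemma homsetP (f : {ffun 'I_5 -> V}) :
  reflect (forall i j, C5 i j -> G (f i) (f j)) (f \in homset).
Proof.
rewrite inE; apply: (iffP forallP) => h i; last first.
  by apply/forallP => j; apply/implyP/h.
by move=> j; apply/implyP; move/forallP: (h i).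
Qed.

Lemma homset_walk5 (f : {ffun 'I_5 -> V}) :
  (f \in homset) = walk5 G (f 0%R) (f 1%R) (f 2%R) (f 3%R) (f 4%R).
Proof.
apply/homsetP/idP => [h|/and5P[h0 h1 h2 h3 h4]].
  by rewrite /walk5 !h.
have h i : G (f i) (f (i + 1)%R).
  have : i \in [:: 0; 1; 2; 3; 4]%R by case: i => [[|[|[|[|[|]]]]]].
  have e2 : (2 + 1 = 3 :> 'I_5)%R by exact: val_inj.
  have e3 : (3 + 1 = 4 :> 'I_5)%R by exact: val_inj.
  have e4 : (4 + 1 = 0 :> 'I_5)%R by exact: val_inj.
  by rewrite !inE => /or4P[|||/orP[]] /eqP ->; rewrite ?add0r ?e2 ?e3 ?e4.
move=> i j; rewrite C5E => /orP[] /eqP -> //.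
by rewrite adj_sym -{2}[i](subrK 1%R).
Qed.

Lemma sum_ffun5 (F : V -> V -> V -> V -> V -> nat) :
  \sum_(f : {ffun 'I_5 -> V}) F (f 0%R) (f 1%R) (f 2%R) (f 3%R) (f 4%R) =
  \sum_a \sum_b \sum_c \sum_d \sum_e F a b c d e.
Proof.
case: (pickP {: V}) => [x0 _|V0]; last first.
  by rewrite !big1 // => [a _|f _]; [have := V0 a | have := V0 (f 0%R)].
pose F' (s : seq V) := F (nth x0 s 0) (nth x0 s 1) (nth x0 s 2) (nth x0 s 3) (nth x0 s 4).
transitivity (\sum_(t : 5.-tuple V) F' t).
  rewrite (reindex (fun t : 5.-tuple V => [ffun i => tnth t i])) /=.
    by apply: eq_bigr => t _; rewrite !ffunE !(tnth_nth x0).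
  exists (fun f => [tuple f i | i < 5]) => [t|f] _.
    by apply: eq_from_tnth => i; rewrite tnth_mktuple ffunE.
  by apply/ffunP => i; rewrite ffunE tnth_mktuple.
rewrite big_tuple_cons; apply: eq_bigr => a _.
rewrite (big_tuple_cons _ (fun s => F' (a :: s))); apply: eq_bigr => b _.
rewrite (big_tuple_cons _ (fun s => F' [:: a, b & s])); apply: eq_bigr => c _.
rewrite (big_tuple_cons _ (fun s => F' [:: a, b, c & s])); apply: eq_bigr => d _.
rewrite (big_tuple_cons _ (fun s => F' [:: a, b, c, d & s])); apply: eq_bigr => e _.
by rewrite (big_tuple0 (fun s => F' [:: a, b, c, d, e & s])).
Qed.

Lemma card_homset : #|homset| = nhom5 G.
Proof.
rewrite -sum1_card big_mkcond.
rewrite -[RHS](sum_ffun5 (fun a b c d e => walk5 G a b c d e)).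
by apply: eq_bigr => f _; rewrite homset_walk5; case: walk5.
Qed.

Hypothesis Gtf : triangle_free G.

Lemma homset_inj (f : {ffun 'I_5 -> V}) : f \in homset -> injective f.
Proof.
move=> /homsetP h i j.
have [|] := boolP (C5 i j); first by move=> /h fij eq; rewrite eq adj_irr in fij.
have main (u : 'I_5) : f u <> f (u + 2)%R.
  move=> eq; apply: (Gtf (x := f u) (y := f (u - 1)%R) (z := f (u - 2)%R)); split.
  - by apply: h; rewrite C5E eqxx orbT.
  - have e : (u - 2 = u - 1 - 1)%R by rewrite -addrA -opprD.
    by apply: h; rewrite C5E e eqxx orbT.
  - have e : (u - 2 = u + 2 + 1)%R by rewrite -addrA; congr (_ + _)%R; exact: val_inj.
    by rewrite eq; apply: h; rewrite C5E e eqxx.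
have : (j - i)%R \in [:: 0; 1; 2; -2; -1]%R by case: (j - i)%R => [[|[|[|[|[|]]]]]].
rewrite !inE !subr_eq C5E => /or4P[/eqP->|||/orP[]].
- by rewrite add0r.
- by rewrite addrC => ->.
- by move=> /eqP -> _; rewrite addrC => /main.
- by move=> /eqP -> _ eq; case: (main (-2 + i)%R); rewrite -eq addrAC addNr add0r.
- by rewrite addrC => ->; rewrite orbT.
Qed.

Definition edge_image (f : {ffun 'I_5 -> V}) : {set {set V}} :=
  [set f @: (a : {set 'I_5}) | a in edges C5].

Lemma five_cyclesE : five_cycles G = edge_image @: homset.
Proof.
apply/setP => E; apply/imsetP/imsetP => -[f fP ->]; exists f => //.
  by move: fP; rewrite !inE => /andP[].
move: (fP); rewrite !inE => ->; rewrite andbT.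
exact/injectiveP/homset_inj.
Qed.

Lemma edge_imageP (f : {ffun 'I_5 -> V}) (e : {set V}) :
  reflect (exists i j, C5 i j /\ e = [set f i; f j]) (e \in edge_image f).
Proof.
apply: (iffP imsetP) => [[a /imsetP[[i j] ij ->] ->]|[i [j [ij ->]]]].
  by exists i, j; rewrite imsetU !imset_set1; move: ij; rewrite inE.
exists [set i; j]; last by rewrite imsetU !imset_set1.
by apply/imsetP; exists (i, j) => //; rewrite inE.
Qed.

Lemma edge_image_comp (f g : {ffun 'I_5 -> V}) (s : 'I_5 * bool) :
  (forall i, g i = f (dihedral s i)) -> edge_image g \subset edge_image f.
Proof.
move=> gE; apply/subsetP => e /edge_imageP[i [j [ij ->]]].
by apply/edge_imageP; exists (dihedral s i), (dihedral s j); rewrite dihedral_C5 !gE.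
Qed.

Lemma set2_inj (T : finType) (x y u v : T) :
  [set x; y] = [set u; v] -> x = u /\ y = v \/ x = v /\ y = u.
Proof.
move=> E.
have: x \in [set u; v] by rewrite -E !inE eqxx.
have: y \in [set u; v] by rewrite -E !inE eqxx orbT.
have: u \in [set x; y] by rewrite E !inE eqxx.
have: v \in [set x; y] by rewrite E !inE eqxx orbT.
rewrite !inE => /orP[]/eqP ? /orP[]/eqP ? /orP[]/eqP ? /orP[]/eqP ?; subst; tauto.
Qed.

Lemma edge_image_dihedral (f g : {ffun 'I_5 -> V}) : f \in homset ->
  g \in homset -> edge_image g = edge_image f ->
  exists s, g = [ffun i => f (dihedral s i)].
Proof.
move=> fh gh E; have f_inj := homset_inj fh.
have adj_fg i j : C5 i j -> exists k l, [/\ C5 k l, g i = f k & g j = f l].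
  move=> ij; have: [set g i; g j] \in edge_image f.
    by rewrite -E; apply/edge_imageP; exists i, j.
  move=> /edge_imageP[k [l [kl /set2_inj[[-> ->]|[-> ->]]]]]; first by exists k, l.
  by exists l, k; rewrite adj_sym.
have range_g i : g i \in codom f.
  have [|k [_ [_ -> _]]] := adj_fg i (i + 1)%R; first by rewrite C5E eqxx.
  exact: codom_f.
pose s i := iinv (range_g i).
have fs i : f (s i) = g i by exact: f_iinv.
have sC5 i j : C5 i j -> C5 (s i) (s j).
  by move=> /adj_fg[k [l [kl]]]; rewrite -!fs => /f_inj-> /f_inj->.
have [d dP] := walk5_C5_dihedral sC5.
by exists d; apply/ffunP => i; rewrite ffunE -dP fs.
Qed.

Lemma card_homset_five_cycles : #|homset| = 10 * #|five_cycles G|.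
Proof.
rewrite five_cyclesE -sum1_card (partition_big_imset edge_image) /=.
rewrite -sum1_card big_distrr; apply: eq_bigr => _ /imsetP[f fh ->] /=.
pose rot (s : 'I_5 * bool) : {ffun 'I_5 -> V} := [ffun i => f (dihedral s i)].
have rot_inj : injective rot.
  move=> s s' /ffunP e; have f_inj := homset_inj fh.
  by apply: dihedral_inj; apply: f_inj; have := e 0%R; have := e 1%R; rewrite !ffunE.
rewrite sum1dep_card muln1 -[RHS](_ : #|[set: 'I_5 * bool]| = 10); last first.
  by rewrite cardsT card_prod card_ord card_bool.
rewrite -(card_imset _ rot_inj); apply: eq_card => g; rewrite inE.
apply/andP/imsetP => [[gh /eqP E]|[s _ ->]].
  by have [s ->] := edge_image_dihedral fh gh E; exists s.
have [s' sK] := dihedral_inv s.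
split.
  by apply/homsetP => i j ij; rewrite !ffunE (homsetP _ fh) // dihedral_C5.
rewrite eqEsubset (edge_image_comp (s := s)) => [|i]; last by rewrite ffunE.
by apply: (edge_image_comp (s := s')) => i; rewrite ffunE sK.
Qed.

End Homs.
(** * Blow-ups of C5 *)

Section Blowup.
Variables (V : finType) (phi : V -> 'I_5).

Definition class_size (i : 'I_5) := #|[set x | phi x == i]|.

Lemma sum_class_size : \sum_i class_size i = #|V|.
Proof.
rewrite -sum1_card (partition_big phi xpredT) //=; apply: eq_bigr => i _.
by rewrite sum1dep_card.
Qed.

Lemma sum_phi (F : 'I_5 -> nat) : \sum_x F (phi x) = \sum_i class_size i * F i.
Proof.
rewrite (partition_big phi xpredT) //=; apply: eq_bigr => i _.
rewrite /class_size -sum1dep_card big_distrl; apply: eq_bigr => x /eqP->.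
by rewrite /= mul1n.
Qed.

Lemma blowup_sym : symmetric (fun x y => C5 (phi x) (phi y)).
Proof. by move=> x y; rewrite adj_sym. Qed.

Lemma blowup_irr : irreflexive (fun x y => C5 (phi x) (phi y)).
Proof. by move=> x; rewrite adj_irr. Qed.

Definition blowup_graph : sgraph V := SGraph blowup_sym blowup_irr.

Lemma prod_dihedral (F : 'I_5 -> nat) (s : 'I_5 * bool) :
  F (dihedral s 0%R) * (F (dihedral s 1%R) * (F (dihedral s 2%R) *
    (F (dihedral s 3%R) * F (dihedral s 4%R)))) = \prod_i F i.
Proof.
have [s' sK] := dihedral_inv s.
have s_inj : injective (dihedral s).
  have s'_inj := can_inj sK; have [t tK s't] := injF_bij s'_inj.
  by move=> x y; rewrite -(s't x) -(s't y) !sK => ->.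
rewrite (reindex_inj s_inj) /= !big_ord_recl big_ord0 muln1.
by congr (F _ * (F _ * (F _ * (F _ * F _)))); congr dihedral; apply: val_inj.
Qed.

Lemma nhom5_blowup : nhom5 blowup_graph = 10 * \prod_i class_size i.
Proof.
pose cs := class_size.
transitivity (\sum_a \sum_b \sum_c \sum_d \sum_e walk5 C5 a b c d e *
    (cs a * (cs b * (cs c * (cs d * cs e))))).
  pose S0 a b c d := \sum_e cs e * walk5 C5 a b c d e.
  pose S1 a b c := \sum_d cs d * S0 a b c d.
  pose S2 a b := \sum_c cs c * S1 a b c.
  transitivity (\sum_a cs a * \sum_b cs b * S2 a b).
    rewrite -(sum_phi (fun a => \sum_b cs b * S2 a b)); apply: eq_bigr => a _.
    rewrite -(sum_phi (S2 (phi a))); apply: eq_bigr => b _.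
    rewrite /S2 -(sum_phi (S1 (phi a) (phi b))); apply: eq_bigr => c _.
    rewrite /S1 -(sum_phi (S0 (phi a) (phi b) (phi c))); apply: eq_bigr => d _.
    by rewrite /S0 -(sum_phi (walk5 C5 (phi a) (phi b) (phi c) (phi d))).
  apply: eq_bigr => a _; rewrite big_distrr; apply: eq_bigr => b _ /=.
  rewrite /S2 !big_distrr; apply: eq_bigr => c _ /=.
  rewrite /S1 !big_distrr; apply: eq_bigr => d _ /=.
  rewrite /S0 !big_distrr; apply: eq_bigr => e _ /=.
  by rewrite [RHS]mulnC !mulnA.
rewrite sum_walk5_C5 (eq_bigr (fun=> \prod_i cs i)) => [|s _].
  by rewrite sum_nat_const card_prod card_ord card_bool.
exact: prod_dihedral.
Qed.

Lemma blowup_triangle_free : triangle_free blowup_graph.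
Proof.
move=> x y z [xy yz xz].
move: (xy : C5 (phi x) (phi y)) (yz : C5 (phi y) (phi z)) (xz : C5 (phi x) (phi z)).
rewrite !C5E; move: (phi x) (phi y) (phi z) => i j k.
by move=> /orP[]/eqP-> /orP[]/eqP->; rewrite -!addrA !(inj_eq (addrI _)).
Qed.

Variable G : sgraph V.
Hypothesis G_phi : forall x y, G x y -> C5 (phi x) (phi y).

Lemma homset_sub_blowup : homset G \subset homset blowup_graph.
Proof.
by apply/subsetP => f /homsetP h; apply/homsetP => i j /h; exact: G_phi.
Qed.

Lemma nhom5_sub_blowup : nhom5 G <= 10 * \prod_i class_size i.
Proof. by rewrite -nhom5_blowup -!card_homset subset_leq_card // homset_sub_blowup. Qed.

Lemma nhom5_sub_blowup_eq : (forall i, 0 < class_size i) ->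
  nhom5 G = 10 * \prod_i class_size i -> C5_blowup_map G phi.
Proof.
move=> cs0; rewrite -nhom5_blowup -!card_homset => E.
have {E} E : homset G = homset blowup_graph.
  by apply/eqP; rewrite eqEcard homset_sub_blowup E leqnn.
have /fin_all_exists[rep repP] : forall i, exists x, phi x = i.
  by move=> i; have /card_gt0P[x] := cs0 i; rewrite inE => /eqP xi; exists x.
move=> x y; apply/idP/idP => [/G_phi //|xy].
pose f : {ffun 'I_5 -> V} :=
  [ffun i => if i == phi x then x else if i == phi y then y else rep i].
have fphi i : phi (f i) = i.
  by rewrite ffunE; case: eqP => [//|_]; case: eqP.
have : f \in homset G.
  by rewrite E; apply/homsetP => i j ij /=; rewrite !fphi.
move=> /homsetP/(_ _ _ xy); rewrite !ffunE !eqxx.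
by case: eqP xy => // ->; rewrite adj_irr.
Qed.
End Blowup.

(* The lemmas [mean_*] say that [x <= q * (1 + 1/q) ^ (x - q)] for every natural x,
   with equality iff x is q or q + 1; multiplying five of these gives the AM-GM
   inequality for integers. *)
Section BalancedProduct.
Variables (q : nat).
Hypothesis q0 : 0 < q.

Lemma pow_below (k : nat) : k <= q -> (q - k) * q.+1 ^ k + (0 < k) <= q ^ k.+1.
Proof.
elim: k => [|k IHk] ltk; first by rewrite subn0 expn0 muln1 addn0 expn1.
have := IHk (ltnW ltk); have P : 0 < q.+1 ^ k by rewrite expn_gt0.
rewrite [q.+1 ^ k.+1]expnS [q ^ k.+2]expnS.
move: (q.+1 ^ k) (q ^ k.+1) P => A B A0 AB.
nia.
Qed.

Lemma pow_above (k : nat) : (q.+1 + k) * q ^ k + (0 < k) <= q.+1 ^ k.+1.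
Proof.
elim: k => [|k IHk]; first by rewrite addn0 expn0 muln1 addn0 expn1.
have P : 0 < q ^ k by rewrite expn_gt0 q0.
move: IHk; rewrite [q.+1 ^ k.+2]expnS [q ^ k.+1]expnS.
move: (q.+1 ^ k.+1) (q ^ k) P => A B B0 AB.
nia.
Qed.

Definition mean_lhs (x : nat) := x * (q ^ x * q.+1 ^ q).
Definition mean_rhs (x : nat) := q.+1 ^ x * q ^ q.+1.

Lemma mean_lt (x : nat) : x != q -> x != q.+1 -> mean_lhs x < mean_rhs x.
Proof.
rewrite /mean_lhs /mean_rhs => xq xq1; have [ltxq|leqx] := ltnP x q.
  have kE : q = x + (q - x.+1).+1 by lia.
  move: (q - x.+1) kE => k kE.
  have := pow_below (k := k.+1); rewrite addn1 => /(_ ltac:(lia)).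
  have -> : q - k.+1 = x by lia.
  rewrite -(ltn_pmul2l (m := q ^ x * q.+1 ^ x)) ?muln_gt0 ?expn_gt0 ?q0 //.
  have E1 : q.+1 ^ q = q.+1 ^ x * q.+1 ^ k.+1 by rewrite -expnD -kE.
  have E2 : q ^ q.+1 = q ^ x * q ^ k.+2 by rewrite -expnD addnS -kE.
  by rewrite E1 E2; nia.
have kE : x = q.+1 + (x - q.+2).+1 by lia.
move: (x - q.+2) kE => k kE.
have := pow_above k.+1; rewrite -kE addn1.
rewrite -(ltn_pmul2l (m := q ^ q.+1 * q.+1 ^ q)) ?muln_gt0 ?expn_gt0 ?q0 //.
have -> : q.+1 ^ x = q.+1 ^ q * q.+1 ^ k.+2 by rewrite -expnD kE addSnnS.
have -> : q ^ x = q ^ q.+1 * q ^ k.+1 by rewrite -expnD -kE.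
by nia.
Qed.

Lemma mean_eq (x : nat) : x = q \/ x = q.+1 -> mean_lhs x = mean_rhs x.
Proof. by rewrite /mean_lhs /mean_rhs !expnS; case=> ->; rewrite ?expnS; lia. Qed.

Lemma mean_le (x : nat) : mean_lhs x <= mean_rhs x.
Proof.
have [->|xq] := eqVneq x q; first by rewrite mean_eq //; left.
have [->|xq1] := eqVneq x q.+1; first by rewrite mean_eq //; right.
exact/ltnW/mean_lt.
Qed.

Variables (X : 'I_5 -> nat) (r : nat).
Hypotheses (r5 : r < 5) (sumX : \sum_i X i = 5 * q + r).

Let D := q ^ (5 * q + r) * q.+1 ^ (5 * q).

Lemma D_gt0 : 0 < D. Proof. by rewrite muln_gt0 !expn_gt0 q0. Qed.

Lemma prod_mean_lhs : \prod_i mean_lhs (X i) = D * \prod_i X i.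
Proof.
rewrite big_split big_split /= mulnC -!expn_sum sumX sum_nat_const card_ord.
by rewrite mulnC.
Qed.

Lemma prod_mean_rhs : \prod_i mean_rhs (X i) = D * (q ^ (5 - r) * q.+1 ^ r).
Proof.
rewrite big_split /= -!expn_sum sumX sum_nat_const card_ord.
have -> : 5 * q.+1 = (5 * q + r) + (5 - r) by lia.
by rewrite !expnD /D !expnD; lia.
Qed.

Lemma prod_le_balanced : \prod_i X i <= q ^ (5 - r) * q.+1 ^ r.
Proof.
rewrite -(leq_pmul2l D_gt0) -prod_mean_lhs -prod_mean_rhs.
by apply: leq_prod => i _; exact: mean_le.
Qed.

Lemma prod_eq_balanced : (forall i, X i = q \/ X i = q.+1) ->
  \prod_i X i = q ^ (5 - r) * q.+1 ^ r.
Proof.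
move=> Xq; apply/eqP; rewrite -(eqn_pmul2l D_gt0) -prod_mean_lhs -prod_mean_rhs.
by apply/eqP/eq_bigr => i _; exact: mean_eq.
Qed.

Lemma balanced_of_prod_eq :
  \prod_i X i = q ^ (5 - r) * q.+1 ^ r -> forall i, X i = q \/ X i = q.+1.
Proof.
move=> E i; have [->|xq] := eqVneq (X i) q; first by left.
have [->|xq1] := eqVneq (X i) q.+1; first by right.
have : \prod_i mean_lhs (X i) = \prod_i mean_rhs (X i).
  by rewrite prod_mean_lhs prod_mean_rhs E.
rewrite (bigD1 i) // [RHS](bigD1 i) //= => H.
have := mean_lt xq xq1.
have : \prod_(j < 5 | j != i) mean_lhs (X j) <= \prod_(j < 5 | j != i) mean_rhs (X j).
  by apply: leq_prod => j _; exact: mean_le.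
have : 0 < \prod_(j < 5 | j != i) mean_rhs (X j).
  by apply: prodn_gt0 => j; rewrite muln_gt0 !expn_gt0 q0.
by move: H; move: (\prod_(j < 5 | j != i) _) (\prod_(j < 5 | j != i) _); nia.
Qed.
End BalancedProduct.

Lemma prod_floor (n : nat) :
  \prod_(i < 5) ((n + i) %/ 5) = (n %/ 5) ^ (5 - n %% 5) * (n %/ 5).+1 ^ (n %% 5).
Proof.
rewrite !big_ord_recl big_ord0 /= /bump /= !add1n addn0.
have := ltn_pmod n (isT : 0 < 5); have := divn_eq n 5.
move: (n %/ 5) (n %% 5) => q r nE r5; rewrite nE.
have E j : j < 10 -> (q * 5 + j) %/ 5 = q + (4 < j) by lia.
rewrite -!addnA !E ?addn0; try lia.
by move: r r5 {nE} => [|[|[|[|[|//]]]]] _ /=; rewrite ?addn0 ?addn1 !expnS; lia.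
Qed.
(** * Graphs on seven and eight vertices *)

Lemma nhom5_bij (V W : finType) (r : rel V) (h : W -> V) : bijective h ->
  nhom5 (relpre h r) = nhom5 r.
Proof.
move=> h_bij; have hP : {on [pred _ | true], bijective h} := onW_bij _ h_bij.
rewrite /nhom5 [RHS](reindex _ hP); apply: eq_bigr => a _.
rewrite [RHS](reindex _ hP); apply: eq_bigr => b _.
rewrite [RHS](reindex _ hP); apply: eq_bigr => c _.
rewrite [RHS](reindex _ hP); apply: eq_bigr => d _.
by rewrite [RHS](reindex _ hP).
Qed.

Lemma sumn_iota (n : nat) (F : nat -> nat) :
  sumn [seq F i | i <- iota 0 n] = \sum_(i < n) F i.
Proof. by rewrite sumnE big_map -(big_mkord xpredT) /index_iota subn0. Qed.

Definition codeg_matrix (n : nat) (K : seq (seq bool)) : seq (seq nat) :=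
  [seq [seq sumn [seq (look K a b && look K b c : nat) | b <- iota 0 n]
    | c <- iota 0 n] | a <- iota 0 n].

(* The trace of the fifth power of the adjacency matrix. *)
Definition trace5 (n : nat) (K : seq (seq bool)) : nat :=
  let M := codeg_matrix n K in
  let m a c := nth 0 (nth [::] M a) c in
  sumn [seq sumn [seq m a c * sumn [seq if look K c d then m d a else 0 | d <- iota 0 n]
    | c <- iota 0 n] | a <- iota 0 n].

Lemma trace5E (n : nat) (K : seq (seq bool)) :
  trace5 n K = nhom5 (fun i j : 'I_n => look K i j).
Proof.
rewrite /trace5; set M := codeg_matrix n K.
have mE (a c : 'I_n) : nth 0 (nth [::] M a) c = \sum_(b < n) (look K a b && look K b c).
  rewrite (nth_map 0) ?size_iota // (nth_map 0) ?size_iota // !nth_iota // !add0n.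
  exact: sumn_iota.
rewrite sumn_iota; apply: eq_bigr => a _; rewrite sumn_iota exchange_big.
apply: eq_bigr => c _; rewrite mE big_distrl; apply: eq_bigr => b _ /=.
rewrite sumn_iota big_distrr; apply: eq_bigr => d _ /=.
rewrite mE /walk5; case: (look K c d); last by rewrite muln0 big1 // => e _; rewrite !andbF.
rewrite big_distrr; apply: eq_bigr => e _ /=.
by rewrite mulnb -andbA.
Qed.

Definition triangle_freeb (n : nat) (K : seq (seq bool)) : bool :=
  all (fun j => all (fun i => look K i j ==>
    all (fun k => ~~ (look K k i && look K k j)) (iota 0 i)) (iota 0 j)) (iota 0 n).

(* In [config7] and [config8] vertices 0 to 4 form the pentagon, 5 is the bad vertex
   and the others are clones. *)
Definition pentagon_rows : seq (seq bool) :=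
  [:: [::]; [:: true]; [:: false; true]; [:: false; false; true];
      [:: true; false; false; true]].

Definition clone_rows : seq (seq bool) :=
  [:: [:: false; true; false; false; true]; [:: true; false; true; false; false];
      [:: false; true; false; true; false]; [:: false; false; true; false; true];
      [:: true; false; false; true; false]].

Definition bad_row (u : bool) : seq bool := [:: u; false; false; false; false].

Definition config7 u (r : seq bool) v : seq (seq bool) :=
  pentagon_rows ++ [:: bad_row u; rcons r v].

Definition config8 u r v r' v' w : seq (seq bool) := config7 u r v ++ [:: r' ++ [:: v'; w]].

Definition ML8_rows : seq (seq bool) :=
  [:: [::]; [:: true]; [:: false; true]; [:: false; false; true];
      [:: true; false; false; true]; [:: false; true; false; false; true];
      [:: false; false; true; false; false; true];
      [:: true; false; false; true; false; false; true]].

Definition bools := [:: true; false].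

Lemma config7_check : all (fun u => all (fun r => all (fun v =>
   let K := config7 u r v in ~~ triangle_freeb 7 K || (trace5 7 K < 40))
  bools) clone_rows) bools.
Proof. by vm_compute. Qed.

Lemma config8_check : all (fun u => all (fun r => all (fun v => all (fun r' =>
  all (fun v' => all (fun w =>
    let K := config8 u r v r' v' w in
    [|| ~~ triangle_freeb 8 K, trace5 8 K < 80 | isob 8 ML8_rows K])
  bools) bools) clone_rows) bools) clone_rows) bools.
Proof. by vm_compute. Qed.

Lemma trace5_ML8 : trace5 8 ML8_rows = 80.
Proof. by vm_compute. Qed.

Section Listing.
Variables (V : finType) (G : sgraph V) (x0 : V) (t : seq V).
Hypotheses (Gtf : triangle_free G) (t_uniq : uniq t) (size_t : size t = #|V|).
Let n := #|V|.

Definition rows : seq (seq bool) :=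
  [seq [seq G (nth x0 t i) (nth x0 t j) | i <- iota 0 j] | j <- iota 0 (size t)].

Lemma look_rows i j : i < n -> j < n -> look rows i j = G (nth x0 t i) (nth x0 t j).
Proof.
have main u v : u < v -> v < n -> nth false (nth [::] rows v) u = G (nth x0 t u) (nth x0 t v).
  move=> uv vn; rewrite (nth_map 0) ?size_iota ?size_t //.
  by rewrite nth_iota ?size_t // add0n (nth_map 0) ?size_iota // nth_iota.
move=> ltin ltjn; rewrite /look; case: ltngtP => [ij|ji|->]; rewrite ?adj_irr //.
  exact: main.
by rewrite adj_sym; exact: main.
Qed.

Lemma nth_bij : bijective (fun i : 'I_n => nth x0 t i).
Proof.
apply: inj_card_bij; last by rewrite card_ord.
move=> i j /eqP; rewrite nth_uniq ?size_t // => /eqP; exact: val_inj.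
Qed.

Lemma nhom5_rows : nhom5 G = trace5 n rows.
Proof.
rewrite trace5E -(nhom5_bij G nth_bij) /nhom5.
do 5!apply: eq_bigr => ? _.
by rewrite /walk5 /= !look_rows.
Qed.

Lemma triangle_free_rows : triangle_freeb n rows.
Proof.
apply/allP => j; rewrite mem_iota => /= ltj; apply/allP => i; rewrite mem_iota => /= lti.
apply/implyP => ij; apply/allP => k; rewrite mem_iota => /= ltk.
have ltin := ltn_trans lti ltj; have ltkn := ltn_trans ltk ltin.
move: ij; rewrite !look_rows // => ij; apply/negP => /andP[ki kj].
by case: (Gtf (And3 ki ij kj)).
Qed.

Lemma isob_isomorphic (W : finType) (H : sgraph W) (L : seq (seq bool)) (h : 'I_n -> W) :
  bijective h -> (forall i j, H (h i) (h j) = look L i j) -> isob n L rows ->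
  isomorphic G H.
Proof.
move=> h_bij hL /isobP[q pq qP].
have qlt (i : 'I_n) : nth 0 q i < n by exact: perm_iota_lt pq (ltn_ord i).
pose g (i : 'I_n) := nth x0 t (nth 0 q i).
have g_bij : bijective g.
  have s_bij : bijective (fun i : 'I_n => Ordinal (qlt i)).
    apply: injF_bij => i j /(congr1 val)/= /eqP.
    rewrite nth_uniq ?(perm_size pq) ?size_iota ?(perm_uniq pq) ?iota_uniq //.
    by move=> /eqP; exact: val_inj.
  exact: (bij_comp nth_bij s_bij).
case: g_bij => g' gK g'K; exists (h \o g'); split; first by apply: bij_comp => //; exists g.
by move=> x y; rewrite /= hL qP // look_rows // -/(g (g' x)) -/(g (g' y)) !g'K.
Qed.
End Listing.

Lemma ML8E (i j : 'I_8) : ML8 i j = look ML8_rows i j.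
Proof.
by case: i => [[|[|[|[|[|[|[|[|//]]]]]]]] ?]; case: j => [[|[|[|[|[|[|[|[|//]]]]]]]] ?].
Qed.

Section BadVertex.
Variables (V : finType) (G : sgraph V).
Hypothesis Gtf : triangle_free G.

Lemma no_triangle x y z : G x y -> G y z -> G x z = false.
Proof. by move=> xy yz; apply/negP => xz; case: (Gtf (And3 xy yz xz)). Qed.

Lemma walk5_rot (r : rel V) a b c d e : walk5 r a b c d e = walk5 r b c d e a.
Proof. by rewrite /walk5; do 4!case: (r _ _); rewrite ?andbT ?andbF. Qed.

Lemma nbrs5_rot (r : rel V) a b c d e x : nbrs5 r a b c d e x = nbrs5 r b c d e a x.
Proof. by rewrite /nbrs5; lia. Qed.

Lemma walk5_nonadj a b c d e : walk5 G a b c d e ->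
  [/\ G a c = false, G b d = false, G c e = false, G a d = false & G b e = false].
Proof.
move=> /and5P[ab bc cd de ea].
split; [exact: no_triangle ab bc | exact: no_triangle bc cd | exact: no_triangle cd de
  | | ].
  by rewrite adj_sym; exact: no_triangle de ea.
by rewrite adj_sym; exact: no_triangle ea ab.
Qed.

Lemma neq_nbr x y z : G z x != G z y -> x != y.
Proof. by apply: contraNneq => ->. Qed.

Lemma walk5_uniq a b c d e : walk5 G a b c d e -> uniq [:: a; b; c; d; e].
Proof.
move=> w; have [ac bd ce ad be] := walk5_nonadj w.
move: w => /and5P[ab bc cd de ea].
have ba : G b a by rewrite adj_sym.
have cb : G c b by rewrite adj_sym.
have ec : G e c = false by rewrite adj_sym.
rewrite /= !inE !negb_or !andbT.
rewrite (neq_nbr (z := a) (x := a)) ?adj_irr ?ab // (neq_nbr (z := e) (y := c)) ?ea ?ec //.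
rewrite (neq_nbr (z := b) (y := d)) ?ba ?bd // (neq_nbr (z := e) (y := e)) ?ea ?adj_irr //.
rewrite (neq_nbr (z := b) (x := b)) ?adj_irr ?bc // (neq_nbr (z := a) (y := d)) ?ab ?ad //.
rewrite (neq_nbr (z := c) (y := e)) ?cb ?ce // (neq_nbr (z := c) (x := c)) ?adj_irr ?cd //.
rewrite (neq_nbr (z := b) (y := e)) ?bc ?be // (neq_nbr (z := d) (x := d)) ?adj_irr ?de //.
Qed.

Lemma walk5_self a b c d e : walk5 G a b c d e -> 1 < nbrs5 G a b c d e a.
Proof.
move=> /and5P[ab _ _ _ ea]; rewrite /nbrs5 adj_irr (adj_sym G b) ab ea.
by case: (G c a); case: (G d a).
Qed.

Lemma walk5_nbrs a b c d e : walk5 G a b c d e ->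
  {in [:: a; b; c; d; e], forall x, 1 < nbrs5 G a b c d e x}.
Proof.
move=> w x; rewrite !inE => /or4P[|||/orP[]] /eqP ->.
- exact: walk5_self.
- by rewrite nbrs5_rot; apply: walk5_self; rewrite -walk5_rot.
- by rewrite 2!nbrs5_rot; apply: walk5_self; rewrite -2!walk5_rot.
- by rewrite 3!nbrs5_rot; apply: walk5_self; rewrite -3!walk5_rot.
- by rewrite 4!nbrs5_rot; apply: walk5_self; rewrite -4!walk5_rot.
Qed.

Lemma clone_row a b c d e x : walk5 G a b c d e -> 1 < nbrs5 G a b c d e x ->
  [:: G a x; G b x; G c x; G d x; G e x] \in clone_rows.
Proof.
move=> /and5P[ab bc cd de ea]; rewrite /nbrs5.
move: (@no_triangle a b x ab) (@no_triangle b c x bc) (@no_triangle c d x cd).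
move: (@no_triangle d e x de) (@no_triangle e a x ea).
by do 5!case: (G _ x); do ?[by [] | move=> /(_ isT) | move=> _].
Qed.

Lemma bad_rowE (u v w x y : bool) : u + (v + (w + (x + y))) <= 1 ->
  u || ~~ [|| v, w, x | y] -> [:: u; v; w; x; y] = bad_row u.
Proof. by case: u; case: v; case: w; case: x; case: y. Qed.

Lemma exists_bad_rot a b c d e : walk5 G a b c d e -> nbad G a b c d e = 1 ->
  exists a b c d e z, [/\ walk5 G a b c d e, [set x | nbrs5 G a b c d e x <= 1] = [set z]
   & [:: G a z; G b z; G c z; G d z; G e z] = bad_row (G a z)].
Proof.
move=> w /eqP/cards1P[z zP].
have zbad a' b' c' d' e' : [set x | nbrs5 G a' b' c' d' e' x <= 1] = [set z] ->
    G a' z || ~~ [|| G b' z, G c' z, G d' z | G e' z] ->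
    [:: G a' z; G b' z; G c' z; G d' z; G e' z] = bad_row (G a' z).
  move=> P; have : z \in [set z] by rewrite inE.
  by rewrite -P inE; exact: bad_rowE.
have rot a' b' c' d' e' : [set x | nbrs5 G a' b' c' d' e' x <= 1] = [set z] ->
    [set x | nbrs5 G b' c' d' e' a' x <= 1] = [set z].
  by move=> <-; apply/setP => x; rewrite !inE -nbrs5_rot.
have zb := rot _ _ _ _ _ zP; have zc := rot _ _ _ _ _ zb.
have zd := rot _ _ _ _ _ zc; have ze := rot _ _ _ _ _ zd.
have wb := w; rewrite walk5_rot in wb; have wc := wb; rewrite walk5_rot in wc.
have wd := wc; rewrite walk5_rot in wd; have we := wd; rewrite walk5_rot in we.
have [bz|bz] := boolP (G b z).
  by exists b, c, d, e, a, z; split=> //; apply: zbad zb _; rewrite bz.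
have [cz|cz] := boolP (G c z).
  by exists c, d, e, a, b, z; split=> //; apply: zbad zc _; rewrite cz.
have [dz|dz] := boolP (G d z).
  by exists d, e, a, b, c, z; split=> //; apply: zbad zd _; rewrite dz.
have [ez|ez] := boolP (G e z).
  by exists e, a, b, c, d, z; split=> //; apply: zbad ze _; rewrite ez.
exists a, b, c, d, e, z; split=> //; apply: zbad => //.
by rewrite (negPf bz) (negPf cz) (negPf dz) (negPf ez) orbT.
Qed.

Lemma good_pentagon_hom a b c d e : walk5 G a b c d e -> nbad G a b c d e = 0 ->
  exists phi : V -> 'I_5, (forall x y, G x y -> C5 (phi x) (phi y)) /\
    forall i, 0 < class_size phi i.
Proof.
move=> w /eqP; rewrite cards_eq0 => /eqP bad0.
have row x : [:: G a x; G b x; G c x; G d x; G e x] \in clone_rows.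
  by apply: (clone_row w); rewrite ltnNge; have := in_set0 x; rewrite -bad0 inE => ->.
pose phi x : 'I_5 := nth 0%R [:: 0; 1; 2; 3; 4]%R
  (index [:: G a x; G b x; G c x; G d x; G e x] clone_rows).
have [ac bd ce ad be] := walk5_nonadj w.
move: w => /and5P[ab bc cd de ea].
exists phi; split=> [x y xy|].
  have common p : ~~ (G p x && G p y).
    by apply/negP => /andP[px py]; case: (Gtf (And3 px xy py)).
  move: (common a) (common b) (common c) (common d) (common e); rewrite /phi.
  move: (row x) (row y); rewrite !inE.
  by move=> /or4P[|||/orP[]] /eqP[-> -> -> -> ->] /or4P[|||/orP[]] /eqP[-> -> -> -> ->];
    vm_compute.
have nbrE x : phi x = nth 0%R [:: 0; 1; 2; 3; 4]%R
  (index [:: G a x; G b x; G c x; G d x; G e x] clone_rows) by [].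
apply: ord5P; apply/card_gt0P; [exists a | exists b | exists c | exists d | exists e];
  rewrite inE nbrE !adj_irr ?(adj_sym G b a) ?(adj_sym G c a) ?(adj_sym G d a)
    ?(adj_sym G c b) ?(adj_sym G d b) ?(adj_sym G e b) ?(adj_sym G d c) ?(adj_sym G e c)
    ?(adj_sym G e d) ?(adj_sym G a e) ?ab ?bc ?cd ?de ?ea ?ac ?bd ?ce ?ad ?be //.
Qed.

Section OneBad.
Variables (a b c d e z : V).
Hypotheses (w : walk5 G a b c d e)
  (zP : [set x | nbrs5 G a b c d e x <= 1] = [set z])
  (z_row : [:: G a z; G b z; G c z; G d z; G e z] = bad_row (G a z)).

Lemma one_bad_listing : exists s, [/\ uniq ([:: a; b; c; d; e; z] ++ s),
  size ([:: a; b; c; d; e; z] ++ s) = #|V| &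
  {in s, forall x, [:: G a x; G b x; G c x; G d x; G e x] \in clone_rows}].
Proof.
have zbad x : (nbrs5 G a b c d e x <= 1) = (x == z).
  by move/setP/(_ x): zP; rewrite !inE.
pose t := [:: a; b; c; d; e; z].
have t_uniq : uniq t.
  have : z \notin [:: a; b; c; d; e].
    by apply/negP => /(walk5_nbrs w); rewrite ltnNge zbad eqxx.
  move: (walk5_uniq w); rewrite -(rev_uniq t) -(rev_uniq [:: a; b; c; d; e]) /= => ->.
  by rewrite andbT -mem_rev.
pose s := [seq x <- enum V | x \notin t].
have ts_uniq : uniq (t ++ s).
  rewrite cat_uniq t_uniq filter_uniq ?enum_uniq // andbT.
  by apply/hasPn => x; rewrite mem_filter => /andP[].
exists s; split=> //.
  rewrite [RHS]cardE; apply/perm_size/uniq_perm; rewrite ?enum_uniq // => x.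
  by rewrite mem_cat mem_filter mem_enum andbT; case: (x \in t).
move=> x; rewrite mem_filter => /andP[xt _]; apply: (clone_row w).
by rewrite ltnNge zbad; move: xt; rewrite !inE !negb_or => /and5P[_ _ _ _ /andP[]].
Qed.

Lemma nhom5_seven : #|V| = 7 -> nhom5 G < 40.
Proof.
move=> V7; have [s [t_uniq size_t s_clone]] := one_bad_listing.
case: s t_uniq size_t s_clone => [|x [|y s]]; rewrite ?V7 //= => t_uniq size_t s_clone.
pose t := [:: a; b; c; d; e; z; x].
have size_t' : size t = #|V| by rewrite V7.
have xP := s_clone x (mem_head _ _).
have [ac bd ce ad be] := walk5_nonadj w.
case/and5P: (w) => ab bc cd de ea.
have E : rows G a t = config7 (G a z) [:: G a x; G b x; G c x; G d x; G e x] (G z x).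
  by rewrite /rows /config7 -z_row /= ab bc cd de (adj_sym G a e) ea ac bd ce ad be.
have := @triangle_free_rows V G a t Gtf size_t'.
rewrite (@nhom5_rows V G a t t_uniq size_t') E V7.
have bP (u : bool) : u \in bools by case: u.
have := allP (allP (allP config7_check _ (bP (G a z))) _ xP) _ (bP (G z x)).
by move=> /= /orP[/negPf->|].
Qed.

Lemma nhom5_eight : #|V| = 8 -> nhom5 G < 80 \/ isomorphic G ML8.
Proof.
move=> V8; have [s [t_uniq size_t s_clone]] := one_bad_listing.
case: s t_uniq size_t s_clone => [|x [|y [|y' s]]]; rewrite ?V8 //= => t_uniq size_t s_clone.
pose t := [:: a; b; c; d; e; z; x; y].
have size_t' : size t = #|V| by rewrite V8.
have xP := s_clone x (mem_head _ _).
have yP := s_clone y (mem_last x [:: y]).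
have [ac bd ce ad be] := walk5_nonadj w.
case/and5P: (w) => ab bc cd de ea.
have E : rows G a t = config8 (G a z) [:: G a x; G b x; G c x; G d x; G e x] (G z x)
    [:: G a y; G b y; G c y; G d y; G e y] (G z y) (G x y).
  by rewrite /rows /config8 /config7 -z_row /= ab bc cd de (adj_sym G a e) ea ac bd ce ad be.
have tf := @triangle_free_rows V G a t Gtf size_t'.
have nE := @nhom5_rows V G a t t_uniq size_t'.
have iso := @isob_isomorphic V G a t t_uniq size_t' _ ML8 ML8_rows.
move: tf nE iso; rewrite E V8 => tf nE iso.
have bP (u : bool) : u \in bools by case: u.
have := allP (allP (allP (allP (allP (allP config8_check _ (bP (G a z))) _ xP)
  _ (bP (G z x))) _ yP) _ (bP (G z y))) _ (bP (G x y)).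
move=> /= /or3P[/negP[]//|lt80|isoK]; first by left; rewrite nE.
right; apply: (iso id) isoK => [|i j]; [by exists id | exact: ML8E].
Qed.
End OneBad.
End BadVertex.

Lemma nhom5_ML8 : nhom5 ML8 = 80.
Proof.
rewrite -trace5_ML8 trace5E /nhom5; do 5!apply: eq_bigr => ? _.
by rewrite /walk5 !ML8E.
Qed.

Lemma ML8_triangle_free : triangle_free ML8.
Proof.
have tfb : all (fun i => all (fun j => all (fun k =>
    ~~ [&& look ML8_rows i j, look ML8_rows j k & look ML8_rows i k])
    (iota 0 8)) (iota 0 8)) (iota 0 8) by vm_compute.
move=> x y z; rewrite !ML8E => -[xy yz xz].
have lt8 (i : 'I_8) : nat_of_ord i \in iota 0 8 by rewrite mem_iota ltn_ord.
have := allP (allP (allP tfb _ (lt8 x)) _ (lt8 y)) _ (lt8 z).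
by rewrite xy yz xz.
Qed.
(** * The extremal number *)

Lemma floor_prod_gt (n : nat) : 10 <= n ->
  8 * n ^ 6 < 250 * (\prod_(i < 5) ((n + i) %/ 5)) * (100 * n + 163).
Proof.
move=> n10; rewrite prod_floor.
have nE := divn_eq n 5; have r5 := ltn_pmod n (isT : 0 < 5).
have q2 : 2 <= n %/ 5 by rewrite leq_divRL.
move: (n %/ 5) (n %% 5) nE r5 q2 => q r -> {n n10} r5 q2.
have -> : q = (q - 2) + 2 by rewrite subnK.
move: (q - 2) => p {q q2}.
by move: r r5 => [|[|[|[|[|//]]]]] _; rewrite ?subSS !subn0 !expnS !expn0; nia.
Qed.

Section Main.
Variables (V : finType) (G : sgraph V).
Let n := #|V|.
Let N := #|five_cycles G|.
Let F := \prod_(i < 5) ((n + i) %/ 5).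

Lemma nhom5_five_cycles : triangle_free G -> nhom5 G = 10 * N.
Proof. by move=> tf; rewrite -card_homset card_homset_five_cycles. Qed.

Lemma walk5_dec (P : nat -> bool) :
  (exists a b c d e, walk5 G a b c d e /\ P (nbad G a b c d e)) \/
  (forall a b c d e, walk5 G a b c d e -> ~~ P (nbad G a b c d e)).
Proof.
case: (pickP (fun p : V * V * V * V * V => let: (a, b, c, d, e) := p in
    walk5 G a b c d e && P (nbad G a b c d e))) => [[[[[a b] c] d] e] /andP[w h]|none].
  by left; exists a, b, c, d, e.
by right=> a b c d e w; have := none (a, b, c, d, e); rewrite /= w => /= ->.
Qed.

Lemma balanced_values (X : 'I_5 -> nat) : \sum_i X i = n ->
  (forall i, X i = n %/ 5 \/ X i = (n %/ 5).+1) ->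
  forall i, X i = n %/ 5 \/ X i = (n + 4) %/ 5.
Proof.
move=> sumX XP i; have [r0|r0] := posnP (n %% 5); last first.
  by case: (XP i) => ->; [left | right; lia].
left; case: (XP i) => // Xi.
have : \sum_(j < 5 | j != i) n %/ 5 <= \sum_(j < 5 | j != i) X j.
  by apply: leq_sum => j _; case: (XP j) => ->.
rewrite sum_nat_const cardC1 card_ord /=.
move: sumX; rewrite (bigD1 i) //= Xi; move: (\sum_(_ < 5 | _) _) n r0 => S m; lia.
Qed.

Lemma five_cycles_good a b c d e : triangle_free G -> walk5 G a b c d e ->
  nbad G a b c d e = 0 -> N <= F /\ (N = F -> balanced_C5_blowup G).
Proof.
move=> tf w bad0; have [phi [G_phi cs0]] := good_pentagon_hom tf w bad0.
have sumX := sum_class_size phi.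
have q0 : 0 < n %/ 5.
  rewrite divn_gt0 // /n -sumX !big_ord_recl big_ord0.
  by move: (cs0 ord0) (cs0 (lift ord0 ord0)) (cs0 (lift ord0 (lift ord0 ord0)))
    (cs0 (lift ord0 (lift ord0 (lift ord0 ord0))))
    (cs0 (lift ord0 (lift ord0 (lift ord0 (lift ord0 ord0))))); lia.
have r5 : n %% 5 < 5 by rewrite ltn_pmod.
have sumX' : \sum_i class_size phi i = 5 * (n %/ 5) + n %% 5.
  by rewrite sumX -/n mulnC -divn_eq.
have leP := prod_le_balanced q0 r5 sumX'.
have := nhom5_sub_blowup G_phi; rewrite (nhom5_five_cycles tf) => leN.
have FE : F = (n %/ 5) ^ (5 - n %% 5) * (n %/ 5).+1 ^ (n %% 5) by exact: prod_floor.
rewrite -FE in leP.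
split; first by lia.
move=> NF; have prodE : \prod_i class_size phi i = F by lia.
exists phi; split.
  by apply: nhom5_sub_blowup_eq => //; rewrite (nhom5_five_cycles tf) prodE NF.
apply: balanced_values => //.
by apply: (balanced_of_prod_eq q0 r5 sumX'); rewrite prodE.
Qed.

Lemma isomorphic_nhom5 (W : finType) (H : sgraph W) :
  isomorphic G H -> nhom5 G = nhom5 H.
Proof.
case=> f [f_bij fE]; rewrite -(nhom5_bij H f_bij) /nhom5.
by do 5!apply: eq_bigr => ? _; rewrite /walk5 /= !fE.
Qed.

Lemma five_cycles_bound (k : nat) : triangle_free G ->
    (forall a b c d e, walk5 G a b c d e -> k <= nbad G a b c d e) ->
  250 * N * (100 * n + 163 * k) <= 8 * n ^ 6.
Proof.
move=> tf bad; have := nhom5_bound tf bad.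
by rewrite (nhom5_five_cycles tf) !mulnA.
Qed.

Lemma five_cycles_bad : triangle_free G -> 5 <= n ->
    (forall a b c d e, walk5 G a b c d e -> 0 < nbad G a b c d e) ->
  N < F \/ [/\ n = 8, N = F & isomorphic G ML8].
Proof.
move=> tf n5 bad; have bound1 := five_cycles_bound tf bad.
have F_at (k : nat) : n = k -> F = \prod_(i < 5) ((k + i) %/ 5) by move=> <-.
have [n10|n9] := leqP 10 n.
  left; have := leq_ltn_trans bound1 (floor_prod_gt n10).
  by rewrite -/F muln1 ltn_pmul2r ?ltn_pmul2l // addn_gt0 orbT.
have NE := nhom5_five_cycles tf.
have one_or_more : (exists a b c d e z, [/\ walk5 G a b c d e,
      [set x | nbrs5 G a b c d e x <= 1] = [set z] &
      [:: G a z; G b z; G c z; G d z; G e z] = bad_row (G a z)]) \/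
    250 * N * (100 * n + 163 * 2) <= 8 * n ^ 6.
  case: (walk5_dec (fun k => k == 1)) => [[a [b [c [d [e [w /eqP bad1]]]]]]|bad1].
    by left; exact: exists_bad_rot w bad1.
  right; apply: five_cycles_bound => // a b c d e w.
  by rewrite ltn_neqAle eq_sym bad1 // bad.
have : [\/ n = 7, n = 8 | n \in [:: 5; 6; 9]].
  by move: n n5 n9 => [|[|[|[|[|[|[|[|[|[|m]]]]]]]]]] // _ _; rewrite ?inE;
    [apply: Or33 | apply: Or33 | apply: Or31 | apply: Or32 | apply: Or33].
move=> [n7|n8|].
- left; have F7 : F = 4 by rewrite (F_at 7 n7) !big_ord_recl big_ord0.
  case: one_or_more => [[a [b [c [d [e [z [w zP z_row]]]]]]]|].
    by have := nhom5_seven tf w zP z_row n7; rewrite NE F7; lia.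
  by rewrite n7 F7; move: (N) => M; clear; rewrite !expnS expn0 => H; lia.
- have F8 : F = 8 by rewrite (F_at 8 n8) !big_ord_recl big_ord0.
  case: one_or_more => [[a [b [c [d [e [z [w zP z_row]]]]]]]|].
    have [lt80|iso] := nhom5_eight tf w zP z_row n8.
      by left; move: lt80; rewrite NE F8; lia.
    right; split=> //; have := isomorphic_nhom5 iso.
    by rewrite nhom5_ML8 NE F8; lia.
  by rewrite n8 F8 => bound2; left; move: (N) bound2 => M; clear; rewrite !expnS expn0; lia.
- have ltF (k f : nat) : \prod_(i < 5) ((k + i) %/ 5) = f ->
      (forall M, 250 * M * (100 * k + 163 * 1) <= 8 * k ^ 6 -> M < f) -> n = k -> N < F.
    by move=> <- lt nk; rewrite (F_at k nk); apply: lt; rewrite -nk.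
  rewrite !inE => /or3P[] /eqP nk; left.
  + apply: (ltF 5 1) nk => [|M]; first by rewrite !big_ord_recl big_ord0.
    by rewrite !expnS expn0; lia.
  + apply: (ltF 6 2) nk => [|M]; first by rewrite !big_ord_recl big_ord0.
    by rewrite !expnS expn0; lia.
  + apply: (ltF 9 16) nk => [|M]; first by rewrite !big_ord_recl big_ord0.
    by rewrite !expnS expn0; lia.
Qed.

Lemma five_cycles_le : triangle_free G -> N <= F.
Proof.
move=> tf; case: (walk5_dec (fun k => k == 0)) => [[a [b [c [d [e [w /eqP good]]]]]]|bad].
  by have [] := five_cycles_good tf w good.
have [n5|n5] := leqP 5 n.
  case: (five_cycles_bad tf n5) => [a b c d e /bad|/ltnW //|[_ -> _] //].
  by rewrite -lt0n.
suff : nhom5 G = 0 by rewrite (nhom5_five_cycles tf); lia.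
rewrite /nhom5; do 5!(rewrite big1 // => ? _).
apply/eqP; rewrite eqb0; apply: contraL n5 => /(walk5_uniq tf)/card_uniqP s5.
by rewrite -leqNgt -[5]s5 max_card.
Qed.

Lemma five_cycles_eq : triangle_free G -> 5 <= n -> N = F ->
  balanced_C5_blowup G \/ (n = 8 /\ isomorphic G ML8).
Proof.
move=> tf n5 NF.
case: (walk5_dec (fun k => k == 0)) => [[a [b [c [d [e [w /eqP good]]]]]]|bad].
  by left; have [_] := five_cycles_good tf w good; apply.
case: (five_cycles_bad tf n5) => [a b c d e /bad||[-> _ iso]]; rewrite -?lt0n //.
  by rewrite NF ltnn.
by right.
Qed.

Lemma balanced_five_cycles : 5 <= n -> balanced_C5_blowup G ->
  triangle_free G /\ N = F.
Proof.
move=> n5 [phi [phiE sizes]].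
have tf : triangle_free G.
  by move=> x y z; rewrite !phiE; exact: (blowup_triangle_free (phi := phi)).
split=> //.
have q0 : 0 < n %/ 5 by rewrite divn_gt0.
have r5 : n %% 5 < 5 by rewrite ltn_pmod.
have sumX : \sum_i class_size phi i = 5 * (n %/ 5) + n %% 5.
  by rewrite sum_class_size -/n mulnC -divn_eq.
have sizes' i : class_size phi i = n %/ 5 \/ class_size phi i = (n %/ 5).+1.
  by rewrite /class_size; case: (sizes i) => ->; rewrite -/n; [left | lia].
have := nhom5_blowup phi; rewrite (prod_eq_balanced q0 r5 sumX sizes') -prod_floor -/F.
have -> : nhom5 (blowup_graph phi) = nhom5 G.
  by rewrite /nhom5; do 5!apply: eq_bigr => ? _; rewrite /walk5 !phiE.
by rewrite (nhom5_five_cycles tf); lia.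
Qed.

Lemma ML8_five_cycles : n = 8 -> isomorphic G ML8 -> triangle_free G /\ N = F.
Proof.
move=> n8 iso; have tf : triangle_free G.
  case: iso => f [_ fE] x y z; rewrite -!fE; exact: ML8_triangle_free.
have F8 : F = 8 by rewrite /F n8 !big_ord_recl big_ord0.
split=> //; have := isomorphic_nhom5 iso.
by rewrite nhom5_ML8 (nhom5_five_cycles tf) F8; lia.
Qed.

End Main.

Lemma card_residue (n i : nat) : i < 5 ->
  \sum_(x < n) (x %% 5 == i) = (n + 4 - i) %/ 5.
Proof.
move=> i5; elim: n => [|n IHn]; first by rewrite big_ord0; lia.
by rewrite big_ord_recr IHn /=; lia.
Qed.

Lemma residue_blowup_balanced (n : nat) : 0 < n ->
  balanced_C5_blowup (blowup_graph (fun x : 'I_n => inord (x %% 5) : 'I_5)).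
Proof.
move=> n0; exists (fun x : 'I_n => inord (x %% 5)); split=> // i.
have -> : #|[set x : 'I_n | inord (x %% 5) == i]| = (n + 4 - i) %/ 5.
  rewrite -card_residue // -sum1dep_card big_mkcond; apply: eq_bigr => x _.
  by rewrite -val_eqE /= inordK ?ltn_pmod //; case: eqP.
by rewrite card_ord; have := ltn_ord i; lia.
Qed.

Theorem theorem2 (n : nat) (hn : 1 <= n) :
  [/\ exists G : sgraph 'I_n,
        triangle_free G /\ #|five_cycles G| = \prod_(i < 5) ((n + i) %/ 5),
      forall G : sgraph 'I_n,
        triangle_free G -> #|five_cycles G| <= \prod_(i < 5) ((n + i) %/ 5)
    & 5 <= n ->
      forall G : sgraph 'I_n,
        (triangle_free G /\ #|five_cycles G| = \prod_(i < 5) ((n + i) %/ 5))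
        <-> (balanced_C5_blowup G \/ (n = 8 /\ isomorphic G ML8))].
Proof.
have upper (G : sgraph 'I_n) : triangle_free G ->
    #|five_cycles G| <= \prod_(i < 5) ((n + i) %/ 5).
  by move=> /five_cycles_le; rewrite card_ord.
split=> //.
  exists (blowup_graph (fun x : 'I_n => inord (x %% 5) : 'I_5)).
  have tf := blowup_triangle_free (phi := fun x : 'I_n => inord (x %% 5) : 'I_5).
  have [n5|n5] := leqP 5 n.
    have := balanced_five_cycles _ (residue_blowup_balanced hn).
    by rewrite card_ord => /(_ n5)[].
  split=> //; apply/eqP; rewrite eqn_leq upper //=.
  by rewrite big_ord_recl /= addn0 divn_small.
move=> n5 G; split=> [[tf E]|[bal|[n8 iso]]].
- by have := five_cycles_eq tf; rewrite card_ord => /(_ n5 E).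
- by have := balanced_five_cycles _ bal; rewrite card_ord => /(_ n5).
- by have := ML8_five_cycles _ iso; rewrite card_ord => /(_ n8).
Qed.
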